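(* Let $\Omega\subset\mathbb{R}^N$ be an exterior domain as in the context. Let $g:[0,\infty)\to(0,1]$ be a monotonically decreasing continuous function such that $\lim_{t\to\infty}g(t)=0$. Then, for any homogeneous $\theta$-boundary condition (with $\theta$ as in the context), there exist an initial value $u_0\in L^1(\Omega)$ with $\|u_0\|_{L^1(\Omega)}=1$ and a sequence of times $t_n\to\infty$ such that $$t_n^{N/2}\left\|S^\theta(t_n)u_0-m_{u_0}\,\Phi^\theta(\cdot)\,G(\cdot,t_n)\right\|_{L^\infty(\Omega)}\geq g(t_n)$$ for every $n$, where $m_{u_0}=\int_\Omega\Phi^\theta(x)u_0(x)\,dx$ and $G(x,t)=\frac{e^{-|x|^2/(4t)}}{(4\pi t)^{N/2}}$.
   Context: Setting. $\Omega=\mathbb{R}^N\setminus\mathcal{C}$ is connected, where the hole $\mathcal{C}$ is a compact set which is the closure of a bounded smooth open set, with $0$ in the interior of $\mathcal{C}$ and $\partial\Omega$ of class $C^{2,\alpha}$ for some $0<\alpha<1$ ($\mathcal{C}$ may have several connected components). The function $\theta:\partial\Omega\to[0,1]$ is of class $C^{1,\alpha}$ for some $0<\alpha<1$ and on each connected component of $\partial\Omega$ satisfies either $\theta\equiv 0$ (Dirichlet) or $0<\theta\leq 1$ (mixed Neumann and Robin; $\theta\equiv1$ is Neumann). The boundary operator is $B_\theta(u)=\sin(\frac{\pi}{2}\theta(x))\frac{\partial u}{\partial n}+\cos(\frac{\pi}{2}\theta(x))u$ on $\partial\Omega$, with $n$ the unit normal pointing out of $\Omega$. Semigroup. $S^\theta(t)$,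 $t>0$, is the heat semigroup in $\Omega$ with boundary condition $B_\theta(u)=0$: on $L^2(\Omega)$ it is generated by the Laplacian with domain $\{u\in W^{2,2}(\Omega): B_\theta(u)=0 \text{ on }\partial\Omega\}$. It has a positive symmetric integral kernel $k^\theta(x,y,t)$, and on $L^p(\Omega)$, $1\leq p\leq\infty$, it is the contraction semigroup given by $S^\theta(t)u_0(x)=\int_\Omega k^\theta(x,y,t)u_0(y)\,dy$. Asymptotic profile. $\Phi^\theta(x)=\lim_{t\to\infty}S^\theta(t)1_\Omega(x)$, $x\in\Omega$ (a monotonically decreasing limit, with $0\leq\Phi^\theta\leq 1$), where $1_\Omega$ is the constant function $1$ on $\Omega$. *)

(* Defs.v *)
From HB Require Import structures.
From mathcomp Require Import all_boot all_order all_algebra.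
From mathcomp Require Import all_classical all_reals all_analysis.

Set Implicit Arguments.
Unset Strict Implicit.
Unset Printing Implicit Defensive.

Import Order.TTheory GRing.Theory Num.Theory.
Import numFieldNormedType.Exports.

Local Open Scope classical_set_scope.
Local Open Scope ring_scope.

(** * Lebesgue measure on row vectors *)

Definition rV_display : measure_display -> measure_display.
Proof. exact. Qed.

Section measurable_rV.
Context {d : measure_display} {T : measurableType d} {n : nat}.

Let coords : 'I_n -> 'rV[T]_n -> T := fun i x => x ord0 i.

Let rV_set0 : g_sigma_preimage coords set0.
Proof. exact: sigma_algebra0. Qed.

Let rV_setC A : g_sigma_preimage coords A -> g_sigma_preimage coords (~` A).
Proof. exact: sigma_algebraC. Qed.

Let rV_bigcup (F : (set 'rV[T]_n)^nat) :
  (forall i, g_sigma_preimage coords (F i)) ->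
  g_sigma_preimage coords (\bigcup_i (F i)).
Proof. exact: sigma_algebra_bigcup. Qed.

HB.instance Definition _ := @isMeasurable.Build (rV_display d)
  'rV[T]_n (g_sigma_preimage coords) rV_set0 rV_setC rV_bigcup.

End measurable_rV.

Section coords.
Context {d : measure_display} {T : measurableType d}.

Lemma measurable_coord n (i : 'I_n) :
  measurable_fun [set: 'rV[T]_n] (fun x : 'rV[T]_n => x ord0 i).
Proof.
move=> _ Y mY; rewrite setTI; apply: sub_sigma_algebra => /=.
rewrite -bigcup_seq/=; exists i => /=; first by rewrite mem_index_enum.
by exists Y => //; rewrite setTI.
Qed.

Lemma measurable_fun_rV d1 (T1 : measurableType d1) n (f : T1 -> 'rV[T]_n) :
  (forall i, measurable_fun [set: T1] (fun x => f x ord0 i)) ->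
  measurable_fun [set: T1] f.
Proof.
move=> mf _ A mA; pose F' := image_set_system setT f (@measurable _ T1).
suff : F' A by [].
apply: mA; split; first exact/sigma_algebra_image/sigma_algebra_measurable.
move=> B; rewrite -bigcup_seq => -[i _ [C mC <-]].
by have := mf i measurableT C mC; rewrite /F' /image_set_system /= !setTI.
Qed.

Definition rV_cons n (p : T * 'rV[T]_n) : 'rV[T]_n.+1 :=
  \row_(i < n.+1) oapp (fun j => p.2 ord0 j) p.1 (unlift ord0 i).

Definition rV_uncons n (x : 'rV[T]_n.+1) : T * 'rV[T]_n :=
  (x ord0 ord0, \row_(j < n) x ord0 (lift ord0 j)).

Lemma rV_consK n : cancel (@rV_cons n) (@rV_uncons n).
Proof.
move=> [a x]; rewrite /rV_uncons /rV_cons; congr pair.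
  by rewrite mxE unlift_none.
by apply/rowP => j; rewrite !mxE liftK.
Qed.

Lemma measurable_rV_cons n : measurable_fun [set: T * 'rV[T]_n] (@rV_cons n).
Proof.
apply: measurable_fun_rV => i.
rewrite (_ : (fun _ => _) = fun p : T * 'rV[T]_n =>
    oapp (fun j => p.2 ord0 j) p.1 (unlift ord0 i)); last first.
  by apply/funext => p; rewrite mxE.
case: (unlift ord0 i) => [j|] /=; last exact: measurable_fst.
exact: (measurableT_comp (measurable_coord j) measurable_snd).
Qed.

Lemma measurable_rV_uncons n :
  measurable_fun [set: 'rV[T]_n.+1] (@rV_uncons n).
Proof.
apply/measurable_fun_pairP; split; first exact: measurable_coord.
apply: measurable_fun_rV => i.
rewrite (_ : (fun _ => _) = fun x : 'rV[T]_n.+1 => x ord0 (lift ord0 i)).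
  exact: measurable_coord.
by apply/funext => x /=; rewrite mxE.
Qed.

End coords.

Section rV_product_measure.
Local Open Scope ereal_scope.
Context {d : measure_display} {T : measurableType d} {R : realType} {n : nat}.
Variable m1 : {sigma_finite_measure set T -> \bar R}.
Variable m2 : {sigma_finite_measure set 'rV[T]_n -> \bar R}.

Definition rV_product_measure : set 'rV[T]_n.+1 -> \bar R :=
  pushforward (m1 \x m2) (@rV_cons d T n).

Let nu0 : rV_product_measure set0 = 0.
Proof. by rewrite /rV_product_measure /pushforward preimage_set0 measure0. Qed.

Let nu_ge0 A : 0 <= rV_product_measure A.
Proof. exact: (measure_ge0 (m1 \x m2)). Qed.

Let nu_sigma_additive : semi_sigma_additive rV_product_measure.
Proof.
move=> F mF tF mUF; rewrite /rV_product_measure /pushforward preimage_bigcup.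
apply: measure_semi_sigma_additive.
- by move=> k; rewrite -[X in measurable X]setTI; exact: measurable_rV_cons.
- apply/trivIsetP => /= i j _ _ ij; rewrite -preimage_setI.
  by move/trivIsetP : tF => /(_ _ _ _ _ ij) ->//; rewrite preimage_set0.
- rewrite -preimage_bigcup -[X in measurable X]setTI.
  exact: measurable_rV_cons.
Qed.

HB.instance Definition _ := isMeasure.Build _ _ _ rV_product_measure
  nu0 nu_ge0 nu_sigma_additive.

Let nu_sigma_finite : sigma_finite setT rV_product_measure.
Proof.
have /sigma_finiteP[F [TF ndF Foo]] := sigma_finiteT m1.
have /sigma_finiteP[G [TG ndG Goo]] := sigma_finiteT m2.
exists (fun k => @rV_uncons d T n @^-1` (F k `*` G k)).
  rewrite -preimage_bigcup (_ : \bigcup_k _ = setT) ?preimage_setT//.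
  apply/seteqP; split=> // -[x y] _.
  have [i _ Fix] : (\bigcup_k F k) x by rewrite -TF.
  have [j _ Gjy] : (\bigcup_k G k) y by rewrite -TG.
  exists (maxn i j) => //; split => /=.
    by move: x Fix; exact/subsetPset/ndF/leq_maxl.
  by move: y Gjy; exact/subsetPset/ndG/leq_maxr.
move=> k; have [mF Fk] := Foo k; have [mG Gk] := Goo k; split.
  rewrite -[X in measurable X]setTI; apply: measurable_rV_uncons => //.
  exact: measurableX.
rewrite /rV_product_measure /pushforward -comp_preimage.
rewrite (_ : _ \o _ = id) ?preimage_id; last exact/funext/rV_consK.
by rewrite product_measure1E// lte_mul_pinfty// ge0_fin_numE.
Qed.

HB.instance Definition _ := Measure_isSigmaFinite.Build _ _ _
  rV_product_measure nu_sigma_finite.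

End rV_product_measure.

(* [measurableTypeR R] is [R] with its Borel sigma-algebra, on which
   [lebesgue_measure] is defined. *)
Fixpoint lebesgue_rV (R : realType) (n : nat) :
    {sigma_finite_measure set 'rV[measurableTypeR R]_n -> \bar R} :=
  match n with
  | 0 => @dirac _ 'rV[measurableTypeR R]_0 (0 : 'rV[R]_0) R
  | n.+1 => rV_product_measure (@lebesgue_measure R) (lebesgue_rV R n)
  end.

(** * Euclidean structure and surface measure *)

(* The norm [`|x|] of the library is the sup norm on ['rV[R]_n]; it induces the
   same topology. *)
Definition enorm (R : realType) n (x : 'rV[R]_n) : R :=
  Num.sqrt (\sum_(i < n) x ord0 i ^+ 2).

Definition ediam (R : realType) n (A : set 'rV[R]_n) : \bar R :=
  ereal_sup [set (enorm (x - y))%:E | x in A & y in A].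

Section hausdorff.
Local Open Scope ereal_scope.
Context {R : realType} {n : nat}.
Variable s : nat.
Local Notation E := 'rV[measurableTypeR R]_n.

(* The value [+oo] excludes the sets of diameter larger than [delta] from the
   coverings over which [mu_ext] takes the infimum. *)
Definition hausdorff_gauge (delta : R) (A : set E) : \bar R :=
  if A == set0 then 0 else
  if ediam A <= delta%:E then ediam A ^+ s else +oo.

Definition hausdorff (A : set E) : \bar R :=
  ereal_sup [set mu_ext (hausdorff_gauge delta) A |
             delta in [set delta : R | (0 < delta)%R]].

Let gauge0 delta : hausdorff_gauge delta set0 = 0.
Proof. by rewrite /hausdorff_gauge eqxx. Qed.

Let gauge_ge0 delta A : 0 <= hausdorff_gauge delta A.
Proof.
rewrite /hausdorff_gauge; case: eqP => // /eqP/set0P[x Ax]; case: ifP => // _.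
apply/expe_ge0/ereal_sup_ubound; exists x => //; exists x => //.
by rewrite subrr /enorm big1 ?sqrtr0// => i _; rewrite mxE expr0n.
Qed.

Let le_hausdorff delta A : (0 < delta)%R ->
  mu_ext (hausdorff_gauge delta) A <= hausdorff A.
Proof. by move=> delta0; apply: ereal_sup_ubound; exists delta. Qed.

Let hausdorff0 : hausdorff set0 = 0.
Proof.
apply/eqP; rewrite eq_le; apply/andP; split.
  by apply: ge_ereal_sup => _ [delta _ <-]; rewrite mu_ext0.
by apply: le_trans (le_hausdorff _ ltr01); rewrite mu_ext_ge0.
Qed.

Let hausdorff_ge0 A : 0 <= hausdorff A.
Proof. by apply: le_trans (le_hausdorff _ ltr01); rewrite mu_ext_ge0. Qed.

Let hausdorff_mono : {homo hausdorff : A B / A `<=` B >-> A <= B}.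
Proof.
move=> A B AB; apply: ge_ereal_sup => _ [delta d0 <-].
exact: le_trans (le_mu_ext _ AB) (le_hausdorff _ d0).
Qed.

Let hausdorff_sigma_subadditive : sigma_subadditive hausdorff.
Proof.
move=> F; apply: ge_ereal_sup => _ [delta d0 <-].
apply: le_trans (mu_ext_sigma_subadditive (gauge_ge0 delta) F) _.
apply: lee_nneseries => [i _ _|i _]; first exact: mu_ext_ge0.
exact: le_hausdorff.
Qed.

HB.instance Definition _ := isOuterMeasure.Build R E hausdorff
  hausdorff0 hausdorff_ge0 hausdorff_mono hausdorff_sigma_subadditive.

End hausdorff.

(* Without the normalizing factor of the (N-1)-dimensional Hausdorff measure:
   below, only null sets and convergence to 0 in L^2 of a boundary matter. *)
Definition surface_outer_measure (R : realType) N :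
    {outer_measure set 'rV[measurableTypeR R]_N -> \bar R} :=
  @hausdorff R N N.-1.

Definition surface_space (R : realType) N :=
  caratheodory_type (surface_outer_measure R N).

Definition surface_measure (R : realType) N :
    {measure set (surface_space R N) -> \bar R} :=
  (surface_outer_measure R N : set (surface_space R N) -> \bar R).

(** * Differentiable functions, domains with regular boundary *)

Section calculus.
Context {R : realType} {N : nat}.
Local Notation E := 'rV[R]_N.
Implicit Types (Omega U : set E) (f u : E -> R).

Definition partial (i : 'I_N) f : E -> R := 'D_(delta_mx 0 i) f.

Definition partials (s : seq 'I_N) f : E -> R := foldr partial f s.

Definition gradient f (x : E) : E := \row_i partial i f x.

Definition C_on U (k : nat) f :=
  forall s : seq 'I_N, (size s <= k)%N -> forall x, U x ->
    {for x, continuous (partials s f)} /\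
    ((size s < k)%N -> forall i, derivable (partials s f) x (delta_mx 0 i)).

Definition hoelder_on U (alpha : R) f :=
  exists M : R, forall x y, U x -> U y ->
    `|f x - f y| <= M * enorm (x - y) `^ alpha.

Definition Calpha_on U (k : nat) (alpha : R) f :=
  C_on U k f /\
  forall s : seq 'I_N, size s = k -> hoelder_on U alpha (partials s f).

Definition smooth f := forall k, C_on setT k f.

Definition boundary Omega : set E := closure Omega `\` interior Omega.

(* [rho] is a local defining function of [Omega]: [Omega] lies in [U] on the
   side [rho < 0] of the regular hypersurface [rho = 0]. *)
Definition defining_function Omega U rho :=
  [/\ open U, C_on U 1 rho, forall x, U x -> gradient rho x != 0 &
      Omega `&` U = [set x | U x /\ rho x < 0]].

Definition boundary_C2alpha Omega (alpha : R) :=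
  forall x, boundary Omega x -> exists U rho,
    [/\ U x, defining_function Omega U rho & Calpha_on U 2 alpha rho].

Definition is_outward_normal Omega (x nu : E) :=
  exists U rho, [/\ U x, defining_function Omega U rho &
    nu = (enorm (gradient rho x))^-1 *: gradient rho x].

Definition outward_normal Omega (x : E) : E := get (is_outward_normal Omega x).

(* C^{1,alpha} functions on the hypersurface [Gamma], through local C^{1,alpha}
   extensions to the ambient space. *)
Definition C1alpha_hypersurface (Gamma : set E) (alpha : R) (theta : E -> R) :=
  forall x, Gamma x -> exists U f,
    [/\ open U, U x, Calpha_on U 1 alpha f &
        forall y, Gamma y -> U y -> theta y = f y].

Record exterior_domain (C : set E) : Prop := {
  hole_compact : compact C ;
  hole_closure : exists O : set E,
    [/\ open O, bounded_set O, C = closure O &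
        exists2 alpha : R, 0 < alpha < 1 & boundary_C2alpha O alpha] ;
  hole_origin : interior C 0 ;
  exterior_connected : connected (~` C) ;
  exterior_boundary :
    exists2 alpha : R, 0 < alpha < 1 & boundary_C2alpha (~` C) alpha }.

Record boundary_parameter Omega (theta : E -> R) : Prop := {
  theta_range : forall x, boundary Omega x -> 0 <= theta x <= 1 ;
  theta_C1alpha : exists2 alpha : R, 0 < alpha < 1 &
    C1alpha_hypersurface (boundary Omega) alpha theta ;
  theta_dichotomy : forall x, boundary Omega x ->
    (forall y, connected_component (boundary Omega) x y -> theta y = 0) \/
    (forall y, connected_component (boundary Omega) x y -> 0 < theta y <= 1) }.

End calculus.

(** * Lebesgue and Sobolev spaces on an open set, traces *)

Section sobolev.
Context {R : realType} {N : nat}.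
Local Notation E := 'rV[R]_N.
Local Notation leb := (lebesgue_rV R N).
Local Notation sigma := (surface_measure R N).
Implicit Types (Omega : set E) (u v w T : E -> R).

Definition norm_Lp Omega (p : \bar R) u : \bar R :=
  Lnorm leb p (EFin \o (u \_ Omega)).

Definition Lp Omega (p : \bar R) u :=
  @measurable_fun _ _ 'rV[measurableTypeR R]_N R Omega u /\
  (norm_Lp Omega p u < +oo)%E.

Definition test_function Omega (phi : E -> R) :=
  smooth phi /\
  exists K : set E, [/\ compact K, K `<=` Omega & forall x, ~ K x -> phi x = 0].

Definition weak_partial Omega (i : 'I_N) u v :=
  forall phi, test_function Omega phi ->
    \int[leb]_(x in Omega) (u x * partial i phi x) =
    - \int[leb]_(x in Omega) (v x * phi x).

(* [u] belongs to W^{1,2}(Omega) and [Du i] are its weak partial derivatives. *)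
Definition W12 Omega u (Du : 'I_N -> E -> R) :=
  Lp Omega 2%:E u /\
  forall i, Lp Omega 2%:E (Du i) /\ weak_partial Omega i u (Du i).

Definition W22 Omega u (Du : 'I_N -> E -> R) (D2u : 'I_N -> 'I_N -> E -> R) :=
  W12 Omega u Du /\ forall i, W12 Omega (Du i) (D2u i).

Definition norm_L2_boundary Omega T : \bar R :=
  Lnorm sigma 2%:E (EFin \o (T \_ (boundary Omega))).

(* The trace is the extension by continuity of the restriction to the boundary
   from the functions smooth up to the boundary, which are dense in
   W^{1,2}(Omega). *)
Definition is_trace Omega u (Du : 'I_N -> E -> R) T :=
  @measurable_fun _ _ (surface_space R N) R (boundary Omega) T /\
  exists phi : nat -> E -> R,
    [/\ forall n, test_function setT (phi n),
        norm_Lp Omega 2%:E (fun x => phi n x - u x) @[n --> \oo] --> 0%E,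
        forall i, norm_Lp Omega 2%:E (fun x => partial i (phi n) x - Du i x)
          @[n --> \oo] --> 0%E &
        norm_L2_boundary Omega (fun x => phi n x - T x) @[n --> \oo] --> 0%E].

(* B_theta(u) = 0 on the boundary of [Omega], for [u] in W^{2,2}(Omega) with
   first and second weak derivatives [Du] and [D2u]. *)
Definition boundary_condition Omega (theta : E -> R) u
    (Du : 'I_N -> E -> R) (D2u : 'I_N -> 'I_N -> E -> R) :=
  exists (Tu : E -> R) (TDu : 'I_N -> E -> R),
    [/\ is_trace Omega u Du Tu,
        forall i, is_trace Omega (Du i) (D2u i) (TDu i) &
        {ae sigma, forall x, boundary Omega x ->
          sin (pi / 2 * theta x) *
            (\sum_(i < N) TDu i x * outward_normal Omega x ord0 i) +
          cos (pi / 2 * theta x) * Tu x = 0}].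

(* The graph of the Laplacian on L^2(Omega) with domain
   {u in W^{2,2}(Omega) : B_theta(u) = 0 on the boundary}. *)
Definition laplacian_graph Omega (theta : E -> R) u w :=
  exists Du D2u, [/\ W22 Omega u Du D2u,
    boundary_condition Omega theta u Du D2u &
    {ae leb, forall x, Omega x -> w x = \sum_(i < N) D2u i i x}].

End sobolev.

(** * The heat semigroup *)

Section heat.
Context {R : realType} {N : nat}.
Local Notation E := 'rV[R]_N.
Local Notation leb := (lebesgue_rV R N).
Implicit Types (Omega : set E) (S : R -> (E -> R) -> E -> R).

(* [S] is, on L^2(Omega), a strongly continuous semigroup of bounded linear
   operators whose generator has the graph [A]. *)
Record L2_semigroup_generated_by Omega S (A : (E -> R) -> (E -> R) -> Prop) :
    Prop := {
  semigroup_bounded : forall t, 0 < t -> exists M : R, forall u,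
    Lp Omega 2%:E u ->
    Lp Omega 2%:E (S t u) /\
    (norm_Lp Omega 2%:E (S t u) <= M%:E * norm_Lp Omega 2%:E u)%E ;
  semigroup_linear : forall t (a : R) u v, 0 < t ->
    Lp Omega 2%:E u -> Lp Omega 2%:E v ->
    {ae leb, forall x, Omega x ->
      S t (fun y => a * u y + v y) x = a * S t u x + S t v x} ;
  semigroup_law : forall s t u, 0 < s -> 0 < t -> Lp Omega 2%:E u ->
    {ae leb, forall x, Omega x -> S (s + t) u x = S s (S t u) x} ;
  semigroup_continuous : forall u, Lp Omega 2%:E u ->
    norm_Lp Omega 2%:E (fun x => S h u x - u x) @[h --> 0^'+] --> 0%E ;
  semigroup_generator : forall u w, Lp Omega 2%:E u -> Lp Omega 2%:E w ->
    (norm_Lp Omega 2%:E (fun x => (S h u x - u x) / h - w x)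
       @[h --> 0^'+] --> 0%E) <-> A u w }.

Definition kernel_operator Omega (k : E -> E -> R -> R) : R -> (E -> R) -> E -> R :=
  fun t u x => \int[leb]_(y in Omega) (k x y t * u y).

Record heat_kernel Omega (theta : E -> R) (k : E -> E -> R -> R) : Prop := {
  kernel_positive : forall x y t, Omega x -> Omega y -> 0 < t -> 0 < k x y t ;
  kernel_symmetric : forall x y t, Omega x -> Omega y -> 0 < t ->
    k x y t = k y x t ;
  kernel_measurable : forall t, 0 < t ->
    @measurable_fun _ _
      ('rV[measurableTypeR R]_N * 'rV[measurableTypeR R]_N)%type R
      (Omega `*` Omega) (fun z => k z.1 z.2 t) ;
  kernel_integrable : forall (p : \bar R) t u x, (1 <= p)%E -> 0 < t ->
    Lp Omega p u -> Omega x ->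
    leb.-integrable Omega (fun y => (k x y t * u y)%:E) ;
  kernel_generator : L2_semigroup_generated_by Omega
    (kernel_operator Omega k) (laplacian_graph Omega theta) ;
  kernel_semigroup : forall (p : \bar R) s t u, (1 <= p)%E -> 0 < s -> 0 < t ->
    Lp Omega p u ->
    {ae leb, forall x, Omega x -> kernel_operator Omega k (s + t) u x =
      kernel_operator Omega k s (kernel_operator Omega k t u) x} ;
  kernel_contraction : forall (p : \bar R) t u, (1 <= p)%E -> 0 < t ->
    Lp Omega p u -> Lp Omega p (kernel_operator Omega k t u) /\
    (norm_Lp Omega p (kernel_operator Omega k t u) <= norm_Lp Omega p u)%E }.

Definition asymptotic_profile Omega S (Phi : E -> R) :=
  forall x, Omega x -> S t (cst 1) x @[t --> +oo] --> Phi x.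

Definition gaussian (x : E) (t : R) : R :=
  expR (- (enorm x ^+ 2 / (4 * t))) / (4 * pi * t) `^ (N%:R / 2).

End heat.

(* Main.v *)
(* The L^1 -> L^infty norm of the error operator u |-> S(t)u - m_u Phi G(., t) does
   not decay faster than t^(-N/2): for a bump u of width r of order t^(1/2), put
   at distance K r from the hole, ||S(t)u - u||_2 <= t ||Laplacian u||_2 keeps S(t)u
   close to u when t / r^2 is small, whereas G(., t) is small on the support of u
   when K is large. The initial value is a gliding hump: a geometrically weighted,
   signed sum of such bumps at scales t_n -> oo, where g(t_n) is far below the n-th
   weight. The sign of the n-th bump is chosen so that the bumps already placed do
   not cancel it; the later ones are negligible at time t_n because the semigroup
   contracts L^infty and their heights are at most of order t_n^(-N/2). *)
Require Import Defs.
From mathcomp Require Import all_boot all_order all_algebra.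
From mathcomp Require Import all_classical all_reals all_analysis.
From mathcomp Require Import measurable_realfun ess_sup_inf.
From mathcomp Require Import ring lra.
Import Order.TTheory GRing.Theory Num.Theory.
Import numFieldNormedType.Exports.
Set Implicit Arguments.
Unset Strict Implicit.
Unset Printing Implicit Defensive.
Local Open Scope classical_set_scope.
Local Open Scope ring_scope.

(** * A smooth bump on the line *)

(** The kernel is tied to the Laplacian only through the generator on L^2, whereas the claim is in
    L^infty. The transfer takes place on a cube of half-width [r]: a sup bound [M] there is an L^2
    bound [M (2r)^(N/2)], a bump of height about 1 has L^2 norm of order [r^(N/2)], and
    [t ||Laplacian u||_2] is of order [(t / r^2) r^(N/2)]. The scale divides out, so one [delta]
    serves all [r]. This dictates the order of choices: [tau = t / r^2] small so that the bump
    survives, then [K], depending on [tau], to make the Gaussian term small. A bump supported in the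
    open domain has zero traces, as has its gradient, so it lies in the domain of the Laplacian for
    every [theta]. Divided by [(2r)^N], a bump has L^1 norm at most 1; for height and mass in this
    proportion the error operator multiplies the height by at most a constant [H]. The ratio [q] of
    the weights is small against [delta / H], so that the tail removes at most half of the n-th
    contribution. Dividing the sum by its L^1 norm, positive and at most 2, costs one more factor
    2. *)

Section bump_tower.
Context {R : realType}.

(** The difference quotient at [x] is at most [c * |h|]. This is what differentiates the bump at the
    endpoints, where it is glued to 0. *)
Lemma is_derive0_of_quadratic (f : R -> R) (x c : R) :
  (forall y, `|f y| <= c * `|y - x| ^+ 2) -> is_derive x 1 f 0.
Proof.
move=> fc.
have fx0 : f x = 0.
  by apply/eqP; rewrite -normr_le0 (le_trans (fc x))// subrr normr0 expr0n mulr0.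
have c0 : 0 <= c.
  by have := fc (x + 1); rewrite [x + 1]addrC addrK normr1 expr1n mulr1; exact: le_trans.
have cv : h^-1 *: (f (h *: 1 + x) - f x) @[h --> 0^'] --> (0 : R).
  apply: norm_cvg0.
  apply: (@squeeze_cvgr _ _ _ _ (cst 0) (fun h : R => c * `|h|)).
  - near=> h; rewrite normr_ge0 /= fx0 subr0 normrZ normfV.
    have h0 : 0 < `|h| by rewrite normr_gt0; near: h; exact: nbhs_dnbhs_neq.
    rewrite ler_pdivrMl// (le_trans (fc _))//.
    by rewrite scaler1 addrK expr2 mulrCA.
  - exact: cvg_cst.
  - rewrite -[X in _ --> X](mulr0 c) -[X in _ * X](@normr0 _ R).
    apply: cvgMl_tmp; apply: cvg_norm.
    exact: (@cvg_within_filter _ _ id).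
split; first by apply/cvg_ex; exists 0.
exact/cvg_lim.
Unshelve. all: by end_near. Qed.

Fixpoint bump_poly (k : nat) : {poly R} :=
  if k is k'.+1 then
    let p := bump_poly k' in
    p^`() * (1 - 'X ^+ 2) ^+ 2 + 'X * p * (1 - 'X ^+ 2) *+ (4 * k') - ('X * p) *+ 2
  else 1.

(* With [y = 1 / (1 - x ^ 2)], so that [y' = 2 x y ^ 2], the k-th derivative of
   [exp (- y)] is [P_k(x) y ^ (2 k) exp (- y)] for the polynomials [P_k] above. *)
Definition bump_fun (k : nat) (x : R) : R :=
  (bump_poly k).[x] * (1 - x ^+ 2)^-1 ^+ (2 * k) * expR (- (1 - x ^+ 2)^-1).

Definition bump (k : nat) (x : R) : R := if `|x| < 1 then bump_fun k x else 0.

Lemma one_sub_sqr_gt0 (x : R) : `|x| < 1 -> 0 < 1 - x ^+ 2.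
Proof. by move=> x1; rewrite subr_gt0 -real_normK ?num_real// expr_lt1. Qed.

Lemma is_derive_bump_fun k (x : R) : `|x| < 1 ->
  is_derive x 1 (bump_fun k) (bump_fun k.+1 x).
Proof.
move=> x1; have q0 := one_sub_sqr_gt0 x1.
have dq : is_derive x 1 (fun x : R => 1 - x ^+ 2) (- (2 * x)).
  apply: is_derive_eq; rewrite /GRing.scale /=; ring.
have dy : is_derive x 1 (fun x : R => (1 - x ^+ 2)^-1)
    (2 * x * (1 - x ^+ 2)^-1 ^+ 2).
  have := @is_deriveV _ (fun x : R => 1 - x ^+ 2) x _ 1 (lt0r_neq0 q0) dq.
  move=> h; apply: is_derive_eq; rewrite /GRing.scale /= exprVn; ring.
have dn : is_derive x 1 (fun x : R => - (1 - x ^+ 2)^-1)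
    (- (2 * x * (1 - x ^+ 2)^-1 ^+ 2)) by apply: is_deriveN.
have de : is_derive x 1 (fun x : R => expR (- (1 - x ^+ 2)^-1))
    (expR (- (1 - x ^+ 2)^-1) * - (2 * x * (1 - x ^+ 2)^-1 ^+ 2)).
  exact: (@is_derive1_comp _ expR _ x).
have dP := is_derive_poly (bump_poly k) x.
have dyk : is_derive x 1 (fun x : R => (1 - x ^+ 2)^-1 ^+ (2 * k))
   ((2 * k)%:R * (1 - x ^+ 2)^-1 ^+ (2 * k).+1 * (2 * x)).
  have := @is_deriveX _ _ (fun x : R => (1 - x ^+ 2)^-1) (2 * k) x 1 _ dy.
  rewrite exprfctE => h; apply: is_derive_eq; rewrite /GRing.scale /=.
  case: (2 * k)%N => [|m] /=; first by rewrite !mul0r.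
  rewrite -mulr_natl /= !exprS; ring.
have := is_deriveM (is_deriveM dP dyk) de => h.
rewrite /bump_fun; apply: is_derive_eq; rewrite /GRing.scale /=.
rewrite !(hornerD, hornerN, hornerMn, hornerM, horner_exp, hornerX, hornerC).
have -> : (2 * k.+1 = (2 * k).+2)%N by rewrite mulnS.
set y := (1 - x ^+ 2)^-1; rewrite !(exprS y (2 * k).+1) !(exprS y (2 * k)).
have yq : y * (1 - x ^+ 2) = 1 by rewrite mulVf ?gt_eqF.
set Y := y ^+ (2 * k).
set p := bump_poly k; set P := p.[x]; set P' := p^`().[x].
set q := 1 - x ^+ 2 in yq *.
(* The middle form contains [q] only through [y * q], which [yq] replaces by 1; each side then
   differs from it by [ring]. *)
transitivity (((P' * (y * q) ^+ 2 + (4 * k)%:R * x * P * y * (y * q)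
  - 2 * x * P * y ^+ 2) * Y) * expR (- y)); last first.
  by rewrite -[_ *+ (4 * k)]mulr_natl; ring.
rewrite yq -[(horner _ * _) x]/(P * Y) !natrM; ring.
Qed.

Lemma poly_bound (p : {poly R}) (x : R) : `|x| < 1 ->
  `|p.[x]| <= \sum_(i < size p) `|p`_i|.
Proof.
move=> x1; rewrite horner_coef (le_trans (ler_norm_sum _ _ _))//.
apply: ler_sum => i _; rewrite normrM normrX ler_piMr//.
by rewrite exprn_ile1// ltW.
Qed.

(** With [q = 1 - x^2], the exponential series gives [q^-(2k+2) <= (2k+2)! exp(1/q)]: two powers
    more than the singular factor of [bump_fun k], and these two are the [q^2] of the bound. The
    polynomial is bounded by the sum of its coefficients in absolute value. *)
Lemma bump_le k : exists2 c : R, 0 <= c &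
  forall x, `|x| < 1 -> `|bump k x| <= c * (1 - x ^+ 2) ^+ 2.
Proof.
pose p := bump_poly k.
exists ((\sum_(i < size p) `|p`_i|) * (2 * k).+2`!%:R).
  by rewrite mulr_ge0// sumr_ge0.
move=> x x1; have q0 := one_sub_sqr_gt0 x1.
rewrite /bump x1 /bump_fun -mulrA normrM -mulrA.
rewrite ler_pM// ?poly_bound//.
rewrite ger0_norm ?mulr_ge0 ?expR_ge0 ?exprn_ge0 ?invr_ge0 ?(ltW q0)//.
set q := 1 - x ^+ 2 in q0 *.
have y0 : 0 <= q^-1 by rewrite invr_ge0 ltW.
have := expR_ge1Dxn (2 * k).+1 y0.
set F : R := (2 * k).+2`!%:R.
have F0 : 0 < F by rewrite ltr0n fact_gt0.
move=> h.
have {h} : q^-1 ^+ (2 * k).+2 <= F * expR q^-1.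
  by rewrite mulrC -ler_pdivrMr// (le_trans _ h)// lerDr.
rewrite expRN ler_pdivrMr ?expR_gt0// -mulrA [q ^+ 2 * _]mulrC mulrA.
rewrite -ler_pdivrMr ?exprn_gt0//; apply: le_trans.
by rewrite -exprVn -exprD addn2.
Qed.

Lemma bump_quadratic k (x : R) : 1 <= `|x| ->
  exists c, forall y, `|bump k y| <= c * `|y - x| ^+ 2.
Proof.
have [c c0 H] := bump_le k.
(* The 4 comes from squaring [1 - y^2 = (1 + |y|) (1 - |y|) <= 2 |y - x|]. *)
move=> x1; exists (c * 4) => y.
have [y1|y1] := ltP `|y| 1; last first.
  by rewrite /bump ltNge y1 normr0 mulr_ge0// mulr_ge0.
rewrite (le_trans (H _ y1))// -mulrA ler_wpM2l//.
rewrite -[y ^+ 2]real_normK ?num_real//.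
have d : 1 - `|y| <= `|y - x|.
  by rewrite distrC (le_trans _ (lerB_dist _ _))// lerB.
have -> : 1 - `|y| ^+ 2 = (1 + `|y|) * (1 - `|y|) by ring.
have y0 : 0 <= `|y| by [].
rewrite exprMn; apply: ler_pM; rewrite ?sqr_ge0//.
  nra.
rewrite lerXn2r ?nnegrE//; lra.
Qed.

(** Inside the interval this is the explicit formula; at and beyond the endpoints the quadratic
    bound gives derivative 0. Since it holds for all [k], every derivative of the bump is known in
    closed form and bounded. *)
Lemma is_derive_bump k (x : R) : is_derive x 1 (bump k) (bump k.+1 x).
Proof.
have [x1|x1] := ltP `|x| 1; last first.
  have [c H] := bump_quadratic k x1.
  by rewrite {2}/bump ltNge x1; exact: is_derive0_of_quadratic H.
rewrite {2}/bump x1; apply: near_eq_is_derive (is_derive_bump_fun k x1).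
have : \forall y \near x, `|y| < 1.
  exact: (@cvgr_norm_lt _ _ _ (nbhs x) _ id x cvg_id).
by apply: filterS => y /= y1; rewrite /bump y1.
Qed.

Lemma bump_bounded k : exists M : R, forall x, `|bump k x| <= M.
Proof.
have [c c0 H] := bump_le k; exists c => x.
have [x1|x1] := ltP `|x| 1; last by rewrite /bump ltNge x1 normr0.
have q0 := one_sub_sqr_gt0 x1.
rewrite (le_trans (H _ x1))// ler_piMr// exprn_ile1//; first exact: ltW.
by rewrite gerBl sqr_ge0.
Qed.

Lemma bump_out k (x : R) : 1 <= `|x| -> bump k x = 0.
Proof. by move=> x1; rewrite /bump ltNge x1. Qed.

Lemma bump_ge0 (x : R) : 0 <= bump 0 x.
Proof.
rewrite /bump; case: ifPn => // _.
by rewrite /bump_fun muln0 expr0 mulr1 /= hornerC mul1r expR_ge0.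
Qed.

Lemma bump_le1 (x : R) : bump 0 x <= 1.
Proof.
rewrite /bump; case: ifPn => // x1.
rewrite /bump_fun muln0 expr0 mulr1 /= hornerC mul1r.
by rewrite expR_le1 oppr_le0 invr_ge0 ltW// one_sub_sqr_gt0.
Qed.

(** Here [1 - x^2 >= 3/4], which more than suffices for an exponent of at least -2. *)
Lemma bump_lower (x : R) : `|x| <= 2^-1 -> expR (- 2) <= bump 0 x.
Proof.
move=> x2; have x1 : `|x| < 1 by lra.
rewrite /bump x1 /bump_fun muln0 expr0 mulr1 /= hornerC mul1r ler_expR lerN2.
rewrite -[leRHS]invrK lef_pV2 ?posrE ?invr_gt0// ?one_sub_sqr_gt0//.
rewrite -[x ^+ 2]real_normK ?num_real//.
have : 0 <= `|x| by []. nra.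
Qed.

End bump_tower.

(** * Lebesgue measure on row vectors *)

Section rV_measure.
Context {R : realType}.
Local Notation mrV n := 'rV[measurableTypeR R]_n.

(** Cubes replace Euclidean balls because the measure is an iterated product and the bumps are
    tensor products. *)
Definition box n (c : 'rV[R]_n) (r : R) : set 'rV[R]_n :=
  [set x | forall i, `|x ord0 i - c ord0 i| <= r].

Lemma measurable_box n (c : 'rV[R]_n) r :
  measurable (box c r : set (mrV n)).
Proof.
rewrite (_ : box c r = \bigcap_(i in [set: 'I_n])
    ((fun x : mrV n => x ord0 i) @^-1` `[c ord0 i - r, c ord0 i + r])).
  apply: fin_bigcap_measurable => // i _.
  rewrite -[X in measurable X]setTI; exact: measurable_coord.
apply/seteqP; split=> [x xc i _|x xc i] /=; first by rewrite in_itv /= -ler_distl.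
by have := xc i Logic.I; rewrite /= in_itv /= -ler_distl.
Qed.

Lemma measurable_ball_rV n (c : 'rV[R]_n) (r : R) : 0 < r ->
  measurable (ball c r : set (mrV n)).
Proof.
move=> r0; rewrite (_ : ball c r = \bigcap_(i in [set: 'I_n])
    ((fun x : mrV n => x ord0 i) @^-1` ball (c ord0 i) r)).
  apply: fin_bigcap_measurable => // i _.
  rewrite -[X in measurable X]setTI; apply: measurable_coord => //.
  exact: measurable_ball.
apply/seteqP; split=> [x [_ xc] i _|x xc]; first exact: xc.
by split=> // i j; rewrite (ord1 i); exact: xc.
Qed.

(** The sigma-algebra is generated by the coordinates, not by the topology, so an open set is
    written as the countable union of the sup-norm balls with rational centre and radius
    [1 / (m + 1)] that it contains. *)
Lemma measurable_open_rV n (U : set 'rV[R]_n) : open U ->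
  measurable (U : set (mrV n)).
Proof.
move=> oU.
pose B (q : 'rV[rat]_n * nat) : set 'rV[R]_n :=
  ball (map_mx ratr q.1 : 'rV[R]_n) q.2.+1%:R^-1.
rewrite (_ : U = \bigcup_q (if `[< B q `<=` U >] then B q else set0)).
  apply: countable_bigcupT_measurable; first exact: countableP.
  move=> q; case: ifPn => _; last exact: measurable0.
  by apply: measurable_ball_rV; rewrite invr_gt0.
apply/seteqP; split=> [x Ux|x [q _]]; last by case: ifPn => // /asboolP; exact.
have /nbhs_ballP[e /= e0 xeU] := open_nbhs_nbhs (conj oU Ux).
have [m me] : exists m : nat, (m.+1%:R^-1 : R) < e / 2.
  have e20 : 0 < e / 2 by rewrite divr_gt0.
  have [m _ H] := near_infty_natSinv_lt (PosNum e20).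
  by exists m; apply: (H m) => /=.
have m0 : 0 < (m.+1%:R^-1 : R) by rewrite invr_gt0.
have /choice[q Hq] : forall i, exists q : rat, ball (x ord0 i) m.+1%:R^-1 (ratr q).
  move=> i; have [z [Hz [q _ qz]]] := @dense_rat R _
    (ex_intro _ _ (ballxx (x ord0 i) m0)) (ball_open _ _).
  by exists q; rewrite qz.
have Bx : B (\row_i q i, m) x.
  by split=> //= i j; rewrite (ord1 i) !mxE; apply: ball_sym.
exists (\row_i q i, m) => //; case: asboolP => //; case=> y By; apply: xeU.
by apply: ball_splitr; apply: le_ball (ltW me) _ _; [exact: Bx|exact: By].
Qed.

Lemma measurable_continuous_rV n (f : 'rV[R]_n -> R) : continuous f ->
  measurable_fun [set: mrV n] f.
Proof.
move=> /continuousP cf; apply: (measurability _ (RGenOpens.measurableE R)).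
move=> _ [_ [a [b ->] <-]]; rewrite setTI; apply: measurable_open_rV.
exact/cf/interval_open.
Qed.

Lemma lebesgue_rV_box n (c : 'rV[R]_n) (r : R) : 0 <= r ->
  lebesgue_rV R n (box c r) = ((2 * r) ^+ n)%:E.
Proof.
move=> r0; elim: n c => [|n IH] c.
  by rewrite /= diracE mem_set// => -[].
rewrite /= /rV_product_measure /pushforward.
rewrite (_ : _ @^-1` _ = `[c ord0 ord0 - r, c ord0 ord0 + r] `*`
    box (\row_j c ord0 (lift ord0 j)) r).
  rewrite product_measure1E//; last exact: measurable_box.
  rewrite IH [X in (X * _)%E](@lebesgue_measure_itv R) /= lte_fin exprS EFinM.
  case: ifPn => [_|]; first by rewrite -EFinB; congr (_%:E * _)%E; ring.
  by rewrite -leNgt => h; have -> : r = 0 by [lra]; rewrite mulr0 mul0e.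
apply/seteqP; split=> [[a x] /= H|[a x] [/= H1 H2] i].
  split=> /=.
    by have := H ord0; rewrite mxE unlift_none /= in_itv /= -ler_distl.
  by move=> j; have := H (lift ord0 j); rewrite !mxE liftK.
rewrite mxE; case: unliftP => [j ->|->] /=.
  by have := H2 j; rewrite mxE.
by move: H1; rewrite in_itv /= -ler_distl.
Qed.

Lemma integrable_bounded_box n (f : 'rV[R]_n -> R) (c : 'rV[R]_n) (r M : R) :
  0 <= r -> measurable_fun [set: mrV n] f -> (forall x, `|f x| <= M) ->
  (forall x, ~ box c r x -> f x = 0) ->
  (lebesgue_rV R n).-integrable [set: mrV n] (EFin \o f).
Proof.
move=> r0 mf fM f0.
apply: (@le_integrable _ _ _ _ _ _ _ (fun x => (M * \1_(box c r : set (mrV n)) x)%:E)).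
- exact: measurableT.
- exact/measurable_EFinP.
- move=> x _; rewrite /= lee_fin normrM indicE.
  have M0 : 0 <= M by rewrite (le_trans _ (fM x)).
  have [xb|xb] := boolP (x \in _); rewrite ?normr1 ?normr0 ?mulr1 ?mulr0.
    by rewrite (le_trans (fM x))// ler_norm.
  by rewrite f0 ?normr0//; move/mem_set; rewrite (negbTE xb).
- under eq_fun do rewrite EFinM; apply: integrableZl => //.
  apply/integrableP; split; first by apply/measurable_EFinP; apply: measurable_indic; exact: measurable_box.
  under eq_integral do rewrite gee0_abs ?lee_fin//.
  rewrite integral_indic//; last exact: measurable_box.
  rewrite setIT; apply: le_lt_trans (ltry ((2 * r) ^+ n)).
  by rewrite le_eqVlt; apply/orP; left; apply/eqP; exact: lebesgue_rV_box.
Qed.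

Lemma integral_derivative_compact (h h' : R -> R) (M : R) : continuous h' ->
  (forall t : R, is_derive t 1 h (h' t)) ->
  (forall t, M < `|t| -> h t = 0 /\ h' t = 0) ->
  (\int[lebesgue_measure]_t (h' t)%:E = 0)%E.
Proof.
move=> ch dh h0.
pose a : R := `|M| + 1.
have aM : M < a by rewrite /a (le_lt_trans (ler_norm M))// ltrDl.
have a0 : 0 < a by rewrite /a ltr_wpDl.
transitivity (\int[lebesgue_measure]_(t in `[(- a)%R, a]) (h' t)%:E)%E.
  rewrite [RHS]integral_mkcond; apply: eq_integral => t _.
  rewrite patchE; case: ifPn => // /negP ta.
  rewrite (h0 t _).2// ltNge; apply/negP => tM; apply: ta; rewrite inE /= in_itv /=.
  by rewrite -ler_norml (le_trans tM)// ltW.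
rewrite (@continuous_FTC2 _ _ h).
- by rewrite (h0 a _).1 ?(h0 (- a) _).1 ?subee// ?normrN gtr0_norm.
- by rewrite gtrN.
- exact: continuous_subspaceT.
- have ch0 : continuous h.
    by move=> t; apply/differentiable_continuous/derivable1_diffP; case: (dh t).
  split.
  + by move=> t _; case: (dh t).
  + exact/cvg_at_right_filter/ch0.
  + exact/cvg_at_left_filter/ch0.
- by move=> t _; rewrite derive1E; case: (dh t).
Qed.

Lemma rV_consD n (a b : R) (x y : 'rV[R]_n) :
  rV_cons (a + b, x + y) = rV_cons (a, x) + rV_cons (b, y).
Proof.
by apply/rowP => i; rewrite !mxE; case: (unlift ord0 i) => [j|] //=; rewrite mxE.
Qed.

Lemma rV_consZ n (a b : R) (x : 'rV[R]_n) :
  rV_cons (a * b, a *: x) = a *: rV_cons (b, x).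
Proof.
by apply/rowP => i; rewrite !mxE; case: (unlift ord0 i) => [j|] //=; rewrite mxE.
Qed.

Lemma rV_cons_delta0 n : rV_cons (1 : R, 0 : 'rV[R]_n) = delta_mx 0 ord0.
Proof.
by apply/rowP => i; rewrite !mxE /=; case: unliftP => [j ->|->] //=; rewrite mxE.
Qed.

Lemma rV_cons_deltaS n (j : 'I_n) :
  rV_cons (0 : R, delta_mx 0 j : 'rV[R]_n) = delta_mx 0 (lift ord0 j).
Proof.
apply/rowP => i; rewrite !mxE /=; case: unliftP => [k ->|->] //=.
by rewrite mxE /= (inj_eq lift_inj).
Qed.

(** The measure in dimension [n.+1] is by construction the pushforward of a product measure under
    [rV_cons]; this form makes Fubini available. *)
Lemma integral_lebesgue_rVS n (f : mrV n.+1 -> \bar R) :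
  (lebesgue_rV R n.+1).-integrable setT f ->
  (\int[lebesgue_rV R n.+1]_x f x =
   \int[(lebesgue_measure \x lebesgue_rV R n)%E]_z f (rV_cons z))%E /\
  (lebesgue_measure \x lebesgue_rV R n)%E.-integrable setT (f \o @rV_cons _ (measurableTypeR R) n).
Proof.
move=> intf.
have mf : measurable_fun setT f by case/integrableP : intf.
have mc := @measurable_rV_cons _ (measurableTypeR R) n.
have intc : (lebesgue_measure \x lebesgue_rV R n)%E.-integrable setT
    (f \o @rV_cons _ (measurableTypeR R) n).
  apply/integrableP; split; first exact: measurableT_comp.
  case/integrableP : intf => _; apply: le_lt_trans.
  rewrite -(@ge0_integral_pushforward _ _ _ _ _ _ mc _ setT (abse \o f))//.
    exact: measurableT_comp.
  by move=> y _; exact: abse_ge0.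
split=> //.
rewrite -(integral_pushforward mc (mu := (lebesgue_measure \x lebesgue_rV R n)%E) (D := setT) mf)//.
Qed.

(** Fubini and induction on the dimension. If [i] is not the first coordinate, the slices with the
    first coordinate fixed integrate to 0 by induction; if it is, each line in that direction
    carries the derivative of a compactly supported function. Continuity and differentiability are
    asked along lines only, so that they pass to slices. *)
Lemma integral_partial_compact n (i : 'I_n) (f f' : 'rV[R]_n -> R) (M B : R) :
  measurable_fun [set: mrV n] f' ->
  (forall x, `|f' x| <= B) ->
  (forall x, continuous (fun t : R => f' (x + t *: delta_mx 0 i))) ->
  (forall x (t : R), is_derive t 1 (fun t => f (x + t *: delta_mx 0 i))
     (f' (x + t *: delta_mx 0 i))) ->
  (forall (x : 'rV[R]_n) j, M < `|x ord0 j| -> f x = 0 /\ f' x = 0) ->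
  (\int[lebesgue_rV R n]_x (f' x)%:E = 0)%E.
Proof.
elim: n i f f' => [[]//|n IH] i f f' mf' fB cf df f0.
have intf : (lebesgue_rV R n.+1).-integrable setT (EFin \o f').
  apply: (@integrable_bounded_box _ _ 0 `|M| B) => // x xM.
  have [j Hj] : exists j, `|M| < `|x ord0 j|.
    apply: contrapT => /forallNP H; apply: xM => j.
    by rewrite mxE subr0 leNgt; apply/negP/H.
  by rewrite (f0 x j _).2// (le_lt_trans (ler_norm _) Hj).
have [-> intc] := integral_lebesgue_rVS intf.
have [j|] := unliftP ord0 i.
  move=> ij; rewrite ij in cf df.
  rewrite -integral12_prod_meas1//.
  rewrite integral0_eq// => a _; rewrite /fubini_F.
  apply: (IH j (fun x => f (rV_cons (a, x))) (fun x => f' (rV_cons (a, x)))).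
  - apply: (measurableT_comp mf').
    apply: (measurableT_comp (@measurable_rV_cons _ (measurableTypeR R) n)).
    exact: measurable_fun_pair.
  - by move=> x.
  - move=> x; have := cf (rV_cons (a, x)).
    by under eq_fun do rewrite -rV_cons_deltaS -rV_consZ mulr0 -rV_consD addr0.
  - move=> x t; have := df (rV_cons (a, x)) t.
    rewrite -rV_cons_deltaS -rV_consZ mulr0 -rV_consD addr0.
    by under eq_fun do rewrite -rV_consZ mulr0 -rV_consD addr0.
  - move=> x k xk; apply: (f0 _ (lift ord0 k)).
    by rewrite mxE liftK.
move=> i0; rewrite i0 in cf df.
rewrite -integral21_prod_meas1//.
rewrite integral0_eq// => y _; rewrite /fubini_G.
have E (t : R) : rV_cons (t, y) = rV_cons (0 : R, y) + t *: delta_mx 0 ord0.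
  by rewrite -rV_cons_delta0 -rV_consZ -rV_consD mulr1 scaler0 addr0 add0r.
apply: (@integral_derivative_compact (fun t => f (rV_cons (t, y))) (fun t => f' (rV_cons (t, y))) M).
- have := cf (rV_cons (0 : R, y)); by under eq_fun do rewrite -E.
- move=> t; have := df (rV_cons (0 : R, y)) t; rewrite -E.
  by under eq_fun do rewrite -E.
- move=> t tM; apply: (f0 _ ord0); by rewrite mxE unlift_none.
Qed.

End rV_measure.

(** * Smooth bumps in the domain of the Laplacian *)

Section general.
Context {R : realType}.

(** The two difference quotients are the same function of [h]; one-variable calculus thus applies to
    directional derivatives. *)
Lemma is_derive_line (V W : normedModType R) (f : V -> W) (x v : V) (t : R) (d : W) :
  is_derive (x + t *: v) v f d <-> is_derive t 1 (fun t : R => f (x + t *: v)) d.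
Proof.
have E : (fun h : R => h^-1 *: ((f \o shift (x + t *: v)) (h *: v) - f (x + t *: v))) =
  (fun h : R => h^-1 *: (((fun t : R => f (x + t *: v)) \o shift t) (h *: 1) -
     f (x + t *: v))).
  apply/funext => h /=; congr (_ *: (f _ - _)).
  by rewrite [h *: 1]mulr1 scalerDl addrCA.
split=> -[dex dval].
  by apply: DeriveDef; rewrite /derivable /derive -E.
by apply: DeriveDef; rewrite /derivable /derive E.
Qed.

End general.

Section integration_by_parts.
Context {R : realType} {N : nat}.
Local Notation E := 'rV[R]_N.
Local Notation mE := 'rV[measurableTypeR R]_N.
Local Notation leb := (lebesgue_rV R N).

Lemma compact_box (c : E) (r : R) : compact (box c r).
Proof.
rewrite (_ : box c r = [set v | forall i, `[c ord0 i - r, c ord0 i + r]%classic (v ord0 i)]).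
  by apply: (@rV_compact _ N (fun i => `[c ord0 i - r, c ord0 i + r]%classic)) => i;
    exact: segment_compact.
by apply/seteqP; split=> x xb i; have := xb i; rewrite /= in_itv /= -ler_distl.
Qed.

Lemma continuous_bounded_box (f : E -> R) (c : E) (r : R) : continuous f ->
  exists M : R, forall x, box c r x -> `|f x| <= M.
Proof.
move=> cf; have : compact (f @` box c r).
  apply: continuous_compact; last exact: compact_box.
  exact: continuous_subspaceT.
move=> /compact_bounded[M [_ HM]]; exists (M + 1) => x xb.
by apply: HM; [rewrite ltrDl|exists x].
Qed.

Lemma continuous_line (f : E -> R) (x v : E) : continuous f ->
  continuous (fun t : R => f (x + t *: v)).
Proof.
move=> cf t; apply: continuous_comp; last exact: cf.
by apply: cvgD; [exact: cvg_cst|apply: cvgZr_tmp; exact: cvg_id].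
Qed.

(** The product [u * phi] inherits the support of [u], so the integral of its derivative over the
    whole space vanishes; as the cube lies in [Omega], integrals over [Omega] are integrals over the
    whole space and no boundary term appears. *)
Lemma integration_by_parts_box (Omega : set E) (c : E) (r : R) (i : 'I_N)
    (u u' phi phi' : E -> R) : 0 <= r -> open Omega -> box c r `<=` Omega ->
  continuous u -> continuous u' -> continuous phi -> continuous phi' ->
  (forall x, is_derive x (delta_mx 0 i) u (u' x)) ->
  (forall x, is_derive x (delta_mx 0 i) phi (phi' x)) ->
  (forall x, ~ box c r x -> u x = 0 /\ u' x = 0) ->
  \int[leb]_(x in Omega) (u x * phi' x) = - \int[leb]_(x in Omega) (u' x * phi x).
Proof.
move=> r0 oO bO cu cu' cp cp' du dp u0.
have intg (f g : E -> R) : continuous f -> continuous g ->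
    (forall x, ~ box c r x -> f x = 0) ->
    leb.-integrable [set: mE] (EFin \o (fun x => f x * g x)).
  move=> cf cg f0.
  have cfg : continuous (fun x => f x * g x).
    by move=> x; exact: (continuousM (cf x) (cg x)).
  have [M HM] := continuous_bounded_box c r cfg.
  apply: (@integrable_bounded_box _ _ _ c r `|M|) => //.
  - exact: measurable_continuous_rV.
  - move=> x; have [xb|xb] := pselect (box c r x).
      by rewrite (le_trans (HM x xb))// ler_norm.
    by rewrite f0// mul0r normr0.
  - by move=> x xb; rewrite f0// mul0r.
have restr (f g : E -> R) : (forall x, ~ box c r x -> f x = 0) ->
    \int[leb]_(x in Omega) (f x * g x) = \int[leb]_x (f x * g x).
  move=> f0; rewrite Rintegral_mkcond; apply: eq_Rintegral => x _.
  rewrite patchE; case: ifPn => // xO; rewrite f0 ?mul0r// => /bO.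
  by move/mem_set; rewrite (negbTE xO).
have u00 x : ~ box c r x -> u x = 0 by move/u0 => [].
have u'00 x : ~ box c r x -> u' x = 0 by move/u0 => [].
rewrite !restr//; apply/eqP; rewrite -addr_eq0 -RintegralD//; last 2 first.
- exact: intg.
- exact: intg.
have cf' : continuous (fun x => u x * phi' x + u' x * phi x).
  move=> x; exact: (continuousD (continuousM (cu x) (cp' x))
    (continuousM (cu' x) (cp x))).
have [M HM] := continuous_bounded_box c r cf'.
suff H : (\int[leb]_x (u x * phi' x + u' x * phi x)%:E = 0)%E by rewrite /Rintegral H.
(* The number [\sum_j |c_j| + r] bounds all coordinates of all points of the cube at once. *)
apply: (@integral_partial_compact R N i (fun x => u x * phi x)
  (fun x => u x * phi' x + u' x * phi x) (\sum_j `|c ord0 j| + r) `|M|).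
- exact: measurable_continuous_rV.
- move=> x; have [xb|xb] := pselect (box c r x).
    by rewrite (le_trans (HM x xb))// ler_norm.
  by rewrite u00// u'00// !mul0r addr0 normr0.
- by move=> x; exact: (@continuous_line (fun x => u x * phi' x + u' x * phi x) x _ cf').
- move=> x t; apply/(@is_derive_line _ _ _ (fun x => u x * phi x)).
  have := is_deriveM (du (x + t *: delta_mx 0 i)) (dp (x + t *: delta_mx 0 i)).
  by rewrite /GRing.scale /= [phi _ * _]mulrC.
- move=> x j xj; have xb : ~ box c r x.
    move=> /(_ j) xb; move: xj; rewrite ltNge => /negP; apply.
    rewrite -[x ord0 j](subrK (c ord0 j)) (le_trans (ler_normD _ _))// addrC.
    by rewrite lerD// (bigD1 j)//= lerDl sumr_ge0.
  by rewrite u00// u'00// !mul0r addr0.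
Qed.

End integration_by_parts.

Section tensor_bump.
Context {R : realType} {N : nat}.
Local Notation E := 'rV[R]_N.
Local Notation mE := 'rV[measurableTypeR R]_N.
Local Notation leb := (lebesgue_rV R N).
Variables (c : E) (r : R).
Hypothesis r0 : 0 < r.

(** [a] is a multi-index: this is the partial derivative of order [a] of the rescaled product bump,
    the powers of [r^-1] coming from the chain rule. The family is closed under [partial], which
    yields smoothness. *)
Definition tbump (a : 'I_N -> nat) (x : E) : R :=
  \prod_i (r^-1 ^+ a i * bump (a i) ((x ord0 i - c ord0 i) / r)).

Definition incr (i : 'I_N) (a : 'I_N -> nat) (j : 'I_N) : nat := (a j + (j == i))%N.

Lemma continuous_bump k : continuous (@bump R k).
Proof.
move=> t; apply/differentiable_continuous/derivable1_diffP.
by case: (is_derive_bump k t).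
Qed.

Lemma continuous_tbump a : continuous (tbump a).
Proof.
apply: (@continuous_big R 'I_N *%R 1 xpredT (@mul_continuous R) E _
  (fun i (x : E) => r^-1 ^+ a i * bump (a i) ((x ord0 i - c ord0 i) / r))) => i _.
have cb : continuous (fun x : E => bump (a i) ((x ord0 i - c ord0 i) / r)).
  move=> x; apply: (@continuous_comp _ _ _
    (fun x : E => (x ord0 i - c ord0 i) / r) (bump (a i))).
    apply: continuousM; last exact: cst_continuous.
    by apply: continuousB; [exact: coord_continuous|exact: cst_continuous].
  exact: continuous_bump.
by move=> x; apply: (@continuousM _ _ (cst (r^-1 ^+ a i)) _ x);
  [exact: cst_continuous|exact: (cb x)].
Qed.

Lemma measurable_tbump a : measurable_fun [set: mE] (tbump a).
Proof. by apply: measurable_continuous_rV; exact: continuous_tbump. Qed.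

Lemma is_derive_tbump a i (x : E) :
  is_derive x (delta_mx 0 i) (tbump a) (tbump (incr i a) x).
Proof.
rewrite -[x in is_derive x]addr0 -[X in _ + X](scale0r (delta_mx 0 i)).
apply/is_derive_line.
pose K := \prod_(j | j != i) (r^-1 ^+ a j * bump (a j) ((x ord0 j - c ord0 j) / r)).
rewrite (_ : (fun t : R => _) = fun t : R =>
   (K * r^-1 ^+ a i) *: bump (a i) (r^-1 * t + (x ord0 i - c ord0 i) / r)); last first.
  apply/funext => t; rewrite /tbump (bigD1 i)//= !mxE eqxx mulr1.
  rewrite /GRing.scale /= mulrC mulrA; congr (_ * _ * bump _ _); last by ring.
  apply: eq_bigr => j ji; rewrite !mxE (negbTE ji) andbF mulr0 addr0//.
have -> : tbump (incr i a) x = (K * r^-1 ^+ a i) *: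
   (r^-1 * bump (a i).+1 (r^-1 * 0 + (x ord0 i - c ord0 i) / r)).
  rewrite mulr0 add0r /tbump (bigD1 i)//= /incr eqxx addn1 exprS.
  rewrite [X in _ * X](_ : _ = K); first by rewrite /GRing.scale /=; ring.
  by apply: eq_bigr => j ji; rewrite (negbTE ji) addn0.
apply: is_deriveZ.
have h1 : is_derive (0 : R) 1 (fun t : R => r^-1 * t + (x ord0 i - c ord0 i) / r) r^-1.
  by apply: is_derive_eq; rewrite /GRing.scale /=; ring.
have h2 := is_derive_bump (a i) (r^-1 * 0 + (x ord0 i - c ord0 i) / r).
have := @is_derive1_comp _ (bump (a i)) (fun t : R => r^-1 * t + (x ord0 i - c ord0 i) / r) 0 _ _ h2 h1.
by rewrite [r^-1 * bump _ _]mulrC.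
Qed.

Lemma tbump_out a (x : E) : ~ box c r x -> tbump a x = 0.
Proof.
move=> xb; have [i Hi] : exists i, r < `|x ord0 i - c ord0 i|.
  apply: contrapT => /forallNP H; apply: xb => j.
  by rewrite leNgt; apply/negP/H.
rewrite /tbump (bigD1 i)//= bump_out ?mulr0 ?mul0r//.
by rewrite normrM normfV (gtr0_norm r0) ler_pdivlMr// mul1r ltW.
Qed.

Lemma tbump_le a (M : nat -> R) (x : E) :
  (forall k t, `|bump k t| <= M k) ->
  `|tbump a x| <= \prod_i (r^-1 ^+ a i * M (a i)).
Proof.
move=> HM; rewrite /tbump normr_prod; apply: ler_prod => i _; rewrite normr_ge0 /=.
rewrite normrM ger0_norm ?exprn_ge0 ?invr_ge0 ?(ltW r0)// ler_wpM2l//.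
by rewrite exprn_ge0// invr_ge0 ltW.
Qed.

Lemma tbump_bounded a : exists M, forall x, `|tbump a x| <= M.
Proof.
have /choice[M HM] := @bump_bounded R.
by eexists => x; exact: tbump_le.
Qed.

Lemma tbump0_ge0 (x : E) : 0 <= tbump (fun=> 0%N) x.
Proof. by apply: prodr_ge0 => i _; rewrite expr0 mul1r bump_ge0. Qed.

Lemma tbump0_le1 (x : E) : tbump (fun=> 0%N) x <= 1.
Proof.
apply: (@le_trans _ _ (\prod_(i < N) 1)); last by rewrite big1.
by apply: ler_prod => i _; rewrite expr0 mul1r bump_ge0 bump_le1.
Qed.

Lemma tbump0_lower (x : E) : box c (r / 2) x -> expR (- 2) ^+ N <= tbump (fun=> 0%N) x.
Proof.
move=> xb; rewrite -[X in _ ^+ X](card_ord N) -prodr_const /tbump.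
apply: ler_prod => i _; rewrite expr0 mul1r expR_ge0 /=; apply: bump_lower.
rewrite normrM normfV (gtr0_norm r0) ler_pdivrMr// mulrC.
exact: xb.
Qed.

Lemma partial_tbump i a : partial i (tbump a) = tbump (incr i a).
Proof. by apply/funext => x; rewrite /partial; case: (is_derive_tbump a i x). Qed.

Lemma partials_tbump s a : exists b, partials s (tbump a) = tbump b.
Proof.
elim: s => [|i s [b IH]]; first by exists a.
by exists (incr i b); rewrite /= IH partial_tbump.
Qed.

Lemma smooth_tbump a : smooth (tbump a).
Proof.
move=> k s _ x _; have [b ->] := partials_tbump s a.
split; first exact: continuous_tbump.
by move=> _ i; case: (is_derive_tbump b i x).
Qed.

Lemma test_function_tbump (U : set E) a : box c r `<=` U -> test_function U (tbump a).
Proof.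
move=> bU; split; first exact: smooth_tbump.
by exists (box c r); split=> //; [exact: compact_box|move=> x; exact: tbump_out].
Qed.

End tensor_bump.

Section norms.
Context {R : realType} {N : nat}.
Local Notation E := 'rV[R]_N.
Local Notation mE := 'rV[measurableTypeR R]_N.
Local Notation leb := (lebesgue_rV R N).

Lemma Lnorm2_ae_le (f g : mE -> R) :
  measurable_fun setT f -> measurable_fun setT g ->
  {ae leb, forall x, `|f x| <= `|g x|} ->
  (Lnorm leb 2%:E (EFin \o f) <= Lnorm leb 2%:E (EFin \o g))%E.
Proof.
move=> mf mg fg; rewrite unlock.
apply: gt0_ler_poweR; rewrite ?invr_ge0//.
- by rewrite in_itv /= leey andbT integral_ge0// => x _; exact: poweR_ge0.
- by rewrite in_itv /= leey andbT integral_ge0// => x _; exact: poweR_ge0.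
apply: ae_ge0_le_integral => //.
- by move=> x _; exact: poweR_ge0.
- apply: (measurableT_comp (measurable_poweR _)).
  by apply: measurableT_comp => //; exact/measurable_EFinP.
- by move=> x _; exact: poweR_ge0.
- apply: (measurableT_comp (measurable_poweR _)).
  by apply: measurableT_comp => //; exact/measurable_EFinP.
apply: filterS fg => x fgx _; by rewrite gt0_ler_poweR// ?in_itv /= ?lee_fin ?normr_ge0 ?leey.
Qed.

Lemma Lnorm2_indic (A : set mE) (M v : R) : measurable A -> 0 <= M -> 0 <= v ->
  leb A = v%:E ->
  Lnorm leb 2%:E (EFin \o (fun x => M * \1_A x)) = (M * Num.sqrt v)%:E.
Proof.
move=> mA M0 v0 Av; rewrite unlock.
have -> : (\int[leb]_x `|(EFin \o (fun x => (M * \1_A x)%R)) x| `^ 2 = (M ^+ 2 * v)%:E)%E.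
  under eq_integral => x _.
    rewrite /= powR_mulrn// normrM exprMn !real_normK ?num_real//.
    rewrite (_ : \1_A x ^+ 2 = \1_A x); last first.
      by rewrite indicE; case: (x \in A); rewrite ?expr1n ?expr0n.
    rewrite EFinM; over.
  rewrite ge0_integralZl_EFin//; last 2 first.
  - by apply/measurable_EFinP; exact: measurable_indic.
  - exact: sqr_ge0.
  rewrite integral_indic// setIT EFinM.
  transitivity (M%:E * M%:E * v%:E)%E; last by rewrite -!EFinM expr2.
  by congr (_ * _)%E; exact: Av.
rewrite poweR_EFin powR12_sqrt ?mulr_ge0 ?sqr_ge0//.
by rewrite sqrtrM ?sqr_ge0// sqrtr_sqr ger0_norm.
Qed.

Lemma norm_L2_box_le (Omega : set E) (f : E -> R) (c : E) (r M : R) :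
  open Omega -> 0 <= r -> 0 <= M -> measurable_fun [set: mE] f ->
  (forall x, `|f x| <= M) -> (forall x, ~ box c r x -> f x = 0) ->
  (norm_Lp Omega 2%:E f <= (M * Num.sqrt ((2 * r) ^+ N))%:E)%E.
Proof.
move=> oO r0 M0 mf fM f0.
have mb : measurable (box c r : set mE) by exact: measurable_box.
rewrite -(Lnorm2_indic mb M0 _ (lebesgue_rV_box c r0)) ?exprn_ge0 ?mulr_ge0//.
apply: Lnorm2_ae_le.
- apply/(measurable_restrictT _ (measurable_open_rV oO)).
  exact: measurable_funTS.
- by apply: measurable_funM => //; exact: measurable_indic.
- apply: aeW => x; rewrite patchE; case: ifPn => xO; last by rewrite normr0.
  rewrite indicE; have [xb|xb] := boolP (x \in _).
    by rewrite mulr1 (ger0_norm M0).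
  by rewrite f0 ?normr0//; move/mem_set; rewrite (negbTE xb).
Qed.

Lemma norm_Lp0 (Omega : set E) (p : \bar R) (f : E -> R) : p != 0%E ->
  (forall x, f x = 0) -> norm_Lp Omega p f = 0%E.
Proof.
move=> p0 f0; rewrite /norm_Lp -(Lnorm0 leb p0); apply: eq_Lnorm => x.
by rewrite /= patchE; case: ifPn => // _; rewrite f0.
Qed.

End norms.

Section laplacian_tbump.
Context {R : realType} {N : nat}.
Local Notation E := 'rV[R]_N.
Local Notation mE := 'rV[measurableTypeR R]_N.
Local Notation leb := (lebesgue_rV R N).
Variables (Omega : set E) (c : E) (r : R).
Hypotheses (r0 : 0 < r) (oO : open Omega) (bO : box c r `<=` Omega).

Lemma Lp2_tbump a : Lp Omega 2%:E (tbump c r a).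
Proof.
split; first by apply: measurable_funTS; exact: measurable_tbump.
have [M HM] := tbump_bounded c r0 a.
apply: le_lt_trans (ltry (`|M| * Num.sqrt ((2 * r) ^+ N))).
apply: (@norm_L2_box_le _ _ _ _ c) => //.
- exact: ltW.
- exact: measurable_tbump.
- by move=> x; rewrite (le_trans (HM x))// ler_norm.
- by move=> x; exact: tbump_out.
Qed.

Lemma W12_tbump a : W12 Omega (tbump c r a) (fun i => tbump c r (incr i a)).
Proof.
split; first exact: Lp2_tbump.
move=> i; split; first exact: Lp2_tbump.
move=> phi [sphi _].
have cphi : continuous phi.
  by move=> x; have [] := sphi 1%N [::] isT x Logic.I.
have cdphi : continuous (partial i phi).
  by move=> x; have [] := sphi 1%N [:: i] isT x Logic.I.
apply: (@integration_by_parts_box _ _ _ c r i) => //.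
- exact: ltW.
- exact: continuous_tbump.
- exact: continuous_tbump.
- by move=> x; exact: is_derive_tbump.
- move=> x; have [_ /(_ isT i) d] := sphi 1%N [::] isT x Logic.I.
  by apply: DeriveDef.
- by move=> x xb; rewrite !tbump_out.
Qed.

(** The bump is a test function on the whole space, so a constant sequence approximates it; its
    restriction to the boundary is 0 because the support lies in the open set [Omega], which is
    disjoint from its boundary. *)
Lemma is_trace_tbump a : is_trace Omega (tbump c r a) (fun i => tbump c r (incr i a)) (cst 0).
Proof.
split; first exact: measurable_cst.
exists (fun=> tbump c r a); split.
- by move=> n; exact: test_function_tbump.
- rewrite norm_Lp0//; first exact: cvg_cst.
  by move=> x; rewrite subrr.
- move=> i; rewrite norm_Lp0//; first exact: cvg_cst.
  by move=> x; rewrite partial_tbump// subrr.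
- rewrite (_ : norm_L2_boundary _ _ = 0%E); first exact: cvg_cst.
  rewrite /norm_L2_boundary -(Lnorm0 (surface_measure R N) (p := 2%:E))//.
  apply: eq_Lnorm => x; rewrite /= patchE; case: ifPn => //.
  rewrite inE => -[_]; rewrite ((interior_id Omega).1 oO) => xO.
  by rewrite tbump_out ?subr0// => /bO.
Qed.

Definition laplacian_bump (x : E) : R :=
  \sum_(i < N) tbump c r (incr i (incr i (fun=> 0%N))) x.

(** The traces of the bump and of its first derivatives are all 0, so the Dirichlet, Neumann and
    Robin conditions hold alike. *)
Lemma laplacian_graph_tbump (theta : E -> R) :
  laplacian_graph Omega theta (tbump c r (fun=> 0%N)) laplacian_bump.
Proof.
exists (fun i => tbump c r (incr i (fun=> 0%N))).
exists (fun i j => tbump c r (incr j (incr i (fun=> 0%N)))); split.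
- by split=> [|i]; exact: W12_tbump.
- exists (cst 0), (fun=> cst 0); split.
  + exact: is_trace_tbump.
  + by move=> i; exact: is_trace_tbump.
  + apply: aeW => x _; rewrite big1 ?mulr0 ?addr0// => i _.
    by rewrite mul0r.
- exact: aeW.
Qed.

Lemma laplacian_bump_out (x : E) : ~ box c r x -> laplacian_bump x = 0.
Proof. by move=> xb; rewrite /laplacian_bump big1// => i _; exact: tbump_out. Qed.

Lemma measurable_laplacian_bump : measurable_fun [set: mE] laplacian_bump.
Proof. by apply: measurable_sum => i; exact: measurable_tbump. Qed.

Lemma laplacian_bump_le (B : R) (x : E) : (forall t, `|bump 2 t| <= B) ->
  `|laplacian_bump x| <= N%:R * (r^-1 ^+ 2 * B).
Proof.
move=> HB.
(* [tbump_le] takes one bound per order. In a pure second derivative one factor has order 2 and the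
   others order 0, with bound 1, so the product collapses to [r^-2 * B]. *)
have Hk k t : `|@bump R k t| <= if k is 0 then 1 else if k == 2 then B else
   xget 0 [set M | forall t, `|bump k t| <= M].
  case: k => [|k]; first by rewrite ger0_norm ?bump_ge0 ?bump_le1.
  case: ifPn => [/eqP ->|_]; first exact: HB.
  case: xgetP => [M _ HM|/(_ _)H]; first exact: HM.
  by have [M HM] := @bump_bounded R k.+1; have := H M; case.
rewrite /laplacian_bump (le_trans (ler_norm_sum _ _ _))//.
rewrite -[X in X%:R * _](card_ord N) mulr_natl -sumr_const.
apply: ler_sum => i _; rewrite (le_trans (tbump_le c r0 _ x Hk))//.
rewrite (bigD1 i)//= big1 ?mulr1 => [|j ji].
  by rewrite /incr eqxx.
by rewrite /incr (negbTE ji) expr0 mulr1.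
Qed.

End laplacian_tbump.

(** * Short-time behaviour of the semigroup *)

Section almost_everywhere.
Context {d : measure_display} {T : measurableType d} {R : realType}.
Variable mu : {measure set T -> \bar R}.

Lemma aeS (P Q : T -> Prop) : (forall x, P x -> Q x) ->
  {ae mu, forall x, P x} -> {ae mu, forall x, Q x}.
Proof. by move=> PQ; apply: filterS. Qed.

Lemma aeS2 (P Q S : T -> Prop) : (forall x, P x -> Q x -> S x) ->
  {ae mu, forall x, P x} -> {ae mu, forall x, Q x} -> {ae mu, forall x, S x}.
Proof. by move=> PQS; apply: filterS2. Qed.

End almost_everywhere.

Section lebesgue_spaces.
Context {R : realType} {N : nat}.
Local Notation E := 'rV[R]_N.
Local Notation mE := 'rV[measurableTypeR R]_N.
Local Notation leb := (lebesgue_rV R N).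
Variables (Omega : set E).
Hypothesis oO : open Omega.
Local Notation mfun := (@measurable_fun _ _ mE R Omega).

Lemma mfun_restrict (u : E -> R) : mfun u -> measurable_fun [set: mE] (u \_ Omega).
Proof. by move=> mu; apply/(measurable_restrictT _ (measurable_open_rV oO)). Qed.

Lemma norm_L2_ae_le (u v : E -> R) : mfun u -> mfun v ->
  {ae leb, forall x, Omega x -> `|u x| <= `|v x|} ->
  (norm_Lp Omega 2%:E u <= norm_Lp Omega 2%:E v)%E.
Proof.
move=> mu mv uv; apply: Lnorm2_ae_le; try exact: mfun_restrict.
apply: aeS uv => x uvx; rewrite !patchE.
by case: ifPn => // xO; apply: uvx; rewrite inE in xO.
Qed.

Lemma norm_LpD (p : \bar R) (u v : E -> R) : (1 <= p)%E -> mfun u -> mfun v ->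
  (norm_Lp Omega p (fun x => (u x + v x)%R) <= norm_Lp Omega p u + norm_Lp Omega p v)%E.
Proof.
move=> p1 mu mv; apply: le_trans (eminkowski leb (mfun_restrict mu) (mfun_restrict mv) p1).
rewrite le_eqVlt; apply/orP; left; apply/eqP; apply: eq_Lnorm => x.
by rewrite /= !patchE; case: ifPn => //; rewrite addr0.
Qed.

Lemma LpD (p : \bar R) (u v : E -> R) : (1 <= p)%E -> Lp Omega p u -> Lp Omega p v ->
  Lp Omega p (fun x => u x + v x).
Proof.
move=> p1 [mu fu] [mv fv]; split; first exact: measurable_funD.
exact: le_lt_trans (norm_LpD p1 mu mv) (lte_add_pinfty fu fv).
Qed.

Lemma norm_L1E (u : E -> R) :
  norm_Lp Omega 1%:E u = (\int[leb]_(x in Omega) `|(u x)%:E|)%E.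
Proof.
rewrite /norm_Lp Lnorm1 [RHS]integral_mkcond; apply: eq_integral => x _.
by rewrite /= !patchE; case: ifPn => //; rewrite normr0.
Qed.

Lemma norm_L2Z (a : R) (u : E -> R) : mfun u ->
  norm_Lp Omega 2%:E (fun x => a * u x) = (`|a|%:E * norm_Lp Omega 2%:E u)%E.
Proof.
move=> mu; rewrite /norm_Lp unlock.
transitivity ((\int[leb]_x ((`|a| `^ 2)%:E * (`|(EFin \o u \_ Omega) x| `^ 2))) `^ 2^-1)%E.
  congr (_ `^ _)%E; apply: eq_integral => x _ /=.
  rewrite -EFinM -powRM// -normrM !patchE.
  by case: ifPn => // _; rewrite mulr0.
rewrite ge0_integralZl//.
- rewrite poweRM ?integral_ge0// ?lee_fin ?powR_ge0//; last first.
  by move=> x _; exact: poweR_ge0.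
  by rewrite poweR_EFin -powRrM mulfV// powRr1.
- apply: (measurableT_comp (measurable_poweR _)).
  by apply: measurableT_comp => //; apply/measurable_EFinP; exact: mfun_restrict.
- by move=> x _; exact: poweR_ge0.
Qed.

Lemma LpZ2 (a : R) (u : E -> R) : Lp Omega 2%:E u -> Lp Omega 2%:E (fun x => a * u x).
Proof.
move=> [mu fu]; split; first exact: measurable_funM.
rewrite norm_L2Z// lte_mul_pinfty//.
Qed.

End lebesgue_spaces.

Section semigroup.
Context {R : realType} {N : nat}.
Local Notation E := 'rV[R]_N.
Local Notation mE := 'rV[measurableTypeR R]_N.
Local Notation leb := (lebesgue_rV R N).
Variables (Omega : set E) (theta : E -> R) (k : E -> E -> R -> R).
Hypothesis oO : open Omega.
Hypothesis hk : heat_kernel Omega theta k.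
Local Notation S := (kernel_operator Omega k).

(** The kernel is integrable against every [Lp] function at each point of [Omega], so linearity
    holds pointwise and not merely almost everywhere. *)
Lemma kernel_operator_linear (p : \bar R) t (a : R) (u v : E -> R) (x : E) : (1 <= p)%E -> 0 < t ->
  Lp Omega p u -> Lp Omega p v -> Omega x ->
  S t (fun y => a * u y + v y) x = a * S t u x + S t v x.
Proof.
move=> p1 t0 Lu Lv xO; rewrite /kernel_operator.
have mO := measurable_open_rV oO.
have iu := kernel_integrable hk p1 t0 Lu xO.
have iv := kernel_integrable hk p1 t0 Lv xO.
rewrite -RintegralZl// -RintegralD//.
- by apply: eq_Rintegral => y _; ring.
- by rewrite (_ : EFin \o _ = fun y => a%:E * (k x y t * u y)%:E)%E//; exact: integrableZl.
Qed.

(** Telescoping: [S((n+2)h)u - u] is [S((n+1)h)(S(h)u - u)] plus [S((n+1)h)u - u], and the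
    contraction property bounds the first term by the norm of [S(h)u - u]. *)
Lemma semigroup_iterate_le (u : E -> R) (h : R) (n : nat) : 0 < h -> Lp Omega 2%:E u ->
  (norm_Lp Omega 2%:E (fun x => (S (n.+1%:R * h) u x - u x)%R) <=
   n.+1%:R%:E * norm_Lp Omega 2%:E (fun x => (S h u x - u x)%R))%E.
Proof.
move=> h0 Lu; have p1 : (1 <= 2%:E :> \bar R)%E by rewrite lee_fin ler1n.
have LN : Lp Omega 2%:E (fun x => - u x).
  have := LpZ2 oO (-1) Lu; by under eq_fun do rewrite mulN1r.
have LS t : 0 < t -> Lp Omega 2%:E (S t u) by move=> t0; exact: (kernel_contraction hk p1 t0 Lu).1.
have LSu t : 0 < t -> Lp Omega 2%:E (fun x => S t u x - u x).
  by move=> t0; apply: LpD => //; exact: LS.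
elim: n => [|n IH]; first by rewrite mul1r mul1e.
have nh0 : 0 < n.+1%:R * h by rewrite mulr_gt0.
have C := kernel_contraction hk p1 nh0 (LSu h h0).
apply: (@le_trans _ _ (norm_Lp Omega 2%:E (fun x =>
  S (n.+1%:R * h) (fun y => S h u y - u y)%R x + (S (n.+1%:R * h) u x - u x))%R)).
  apply: norm_L2_ae_le => //.
  - by case: (LSu (n.+2%:R * h)); rewrite ?mulr_gt0.
  - by apply: measurable_funD; [case: C => -[]|case: (LSu _ nh0)].
  have := kernel_semigroup hk p1 nh0 h0 Lu; apply: aeS => x H xO.
  rewrite (_ : n.+2%:R * h = n.+1%:R * h + h) ?H//; last first.
    by rewrite -[in LHS]addn1 natrD mulrDl mul1r.
  have -> : (fun y => S h u y - u y) = (fun y => (-1) * u y + S h u y).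
    by apply/funext => y; rewrite mulN1r addrC.
  rewrite (kernel_operator_linear _ p1)//; last exact: LS.
  by rewrite mulN1r le_eqVlt; apply/orP; left; apply/eqP; congr `|_|; ring.
apply: le_trans (norm_LpD _ _ _ _) _ => //.
- by case: C => -[].
- by case: (LSu _ nh0).
have -> : (n.+2%:R%:E = n.+1%:R%:E + 1%:E :> \bar R)%E.
  by rewrite -EFinD -[in LHS]addn1 natrD.
rewrite ge0_muleDl// addeC leeD//.
by rewrite mul1e; exact: C.2.
Qed.

(** This is the bound read off from [S(t)u - u = int_0^t S(s)w ds], obtained without a vector-valued
    integral: [t] is cut into equal steps [h] so short that [(S(h)u - u) / h] is within [e / t] of
    [w], and telescoping multiplies the bound by [t]. *)
Lemma semigroup_sub_le (u w : E -> R) (t : R) : 0 < t -> Lp Omega 2%:E u ->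
  Lp Omega 2%:E w -> laplacian_graph Omega theta u w ->
  (norm_Lp Omega 2%:E (fun x => (S t u x - u x)%R) <= t%:E * norm_Lp Omega 2%:E w)%E.
Proof.
move=> t0 Lu Lw /(semigroup_generator (kernel_generator hk) Lu Lw) cv.
have p1 : (1 <= 2%:E :> \bar R)%E by rewrite lee_fin ler1n.
have LN : Lp Omega 2%:E (fun x => - u x).
  have := LpZ2 oO (-1) Lu; by under eq_fun do rewrite mulN1r.
have LNw : Lp Omega 2%:E (fun x => - w x).
  have := LpZ2 oO (-1) Lw; by under eq_fun do rewrite mulN1r.
have LSu s : 0 < s -> Lp Omega 2%:E (fun x => S s u x - u x).
  by move=> s0; apply: LpD => //; exact: (kernel_contraction hk p1 s0 Lu).1.
apply/lee_addgt0Pr => e e0.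
have et0 : 0 < e / t by rewrite divr_gt0.
have [n Hn] : exists n : nat, (norm_Lp Omega 2%:E (fun x =>
    (S (t / n.+1%:R) u x - u x) / (t / n.+1%:R) - w x)%R <= (e / t)%:E)%E.
  have : \forall h \near 0^'+, (norm_Lp Omega 2%:E (fun x =>
      (S h u x - u x) / h - w x)%R < (e / t)%:E)%E.
    exact: (cv [set y | (y < (e / t)%:E)%E] (open_ereal_lt' _)).
  move=> /nbhs_ballP[d /= d0 Hd].
  have dt0 : 0 < d / t by rewrite divr_gt0.
  have [n _ Hn] := near_infty_natSinv_lt (PosNum dt0).
  have tn0 : 0 < t / n.+1%:R by rewrite divr_gt0.
  exists n; apply/ltW/Hd => //=.
  rewrite /ball /= sub0r normrN gtr0_norm// mulrC -ltr_pdivlMr//.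
  exact: (Hn n (leqnn n)).
set h := t / n.+1%:R in Hn *.
have h0 : 0 < h by rewrite divr_gt0.
have th : t = n.+1%:R * h by rewrite /h mulrCA mulfV ?mulr1// pnatr_eq0.
have := semigroup_iterate_le n h0 Lu; rewrite -th => /le_trans; apply.
have -> : norm_Lp Omega 2%:E (fun x => S h u x - u x) =
   (h%:E * norm_Lp Omega 2%:E (fun x => (S h u x - u x) / h)%R)%E.
  rewrite -[in LHS](_ : (fun x => h * ((S h u x - u x) / h)) = (fun x => S h u x - u x)); last first.
    by apply/funext => x; rewrite mulrCA mulfV ?mulr1// gt_eqF.
  rewrite norm_L2Z// ?gtr0_norm//.
  by apply: measurable_funM => //; case: (LSu h h0).
rewrite muleA -EFinM -th.
apply: (@le_trans _ _ (t%:E * ((e / t)%:E + norm_Lp Omega 2%:E w))%E); last first.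
  by rewrite muleDr ?fin_num_adde_defr// -EFinM mulrCA mulfV ?mulr1 ?gt_eqF// addeC.
rewrite lee_pmul2l//.
apply: le_trans (leeD Hn (lexx _)).
apply: le_trans (norm_LpD oO p1 _ _).
- by under [in leRHS]eq_fun do rewrite subrK.
- apply: measurable_funD; last by case: LNw.
  by apply: measurable_funM => //; case: (LSu h h0).
- by case: Lw.
Qed.

(** On the half-size cube [exp(-2)^N <= u <= |S(t)u - u| + |S(t)u - F| + |F|]. The L^2 norm of the
    left side is [exp(-2)^N r^(N/2)]; on the right the generator bounds the first term and [M + L]
    on the full cube the other two, both with the factor [(2r)^(N/2)]. Dividing by [r^(N/2)] leaves
    [sqrt(2^N)]. *)
Lemma bump_lower_bound (c : E) (r t B M L : R) (F : E -> R) :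
  0 < r -> box c r `<=` Omega -> 0 < t -> 0 <= M -> 0 <= L ->
  (forall s, `|@bump R 2 s| <= B) ->
  {ae leb, forall x, Omega x -> `|S t (tbump c r (fun=> 0%N)) x - F x| <= M} ->
  {ae leb, forall x, box c r x -> `|F x| <= L} ->
  expR (- 2) ^+ N <= Num.sqrt (2 ^+ N) * (t * (N%:R * (r^-1 ^+ 2 * B)) + (M + L)).
Proof.
move=> r0 bO t0 M0 L0 HB HM HL.
set u := tbump c r _ in HM *; set w := laplacian_bump c r.
have p1 : (1 <= 2%:E :> \bar R)%E by rewrite lee_fin ler1n.
have B0 : 0 <= B by rewrite (le_trans _ (HB 0)).
have mw : measurable_fun [set: mE] w by exact: measurable_laplacian_bump.
have C0 : 0 <= N%:R * (r^-1 ^+ 2 * B).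
  by rewrite mulr_ge0// mulr_ge0// exprn_ge0// invr_ge0 ltW.
have nw := norm_L2_box_le oO (ltW r0) C0 mw (fun x => laplacian_bump_le c r0 x HB)
  (@laplacian_bump_out _ _ _ _ r0).
have Lu : Lp Omega 2%:E u by exact: Lp2_tbump.
have Lw : Lp Omega 2%:E w.
  by split; [exact: measurable_funTS|exact: le_lt_trans nw (ltry _)].
have := semigroup_sub_le t0 Lu Lw (laplacian_graph_tbump r0 oO bO theta) => nS.
have mb : measurable (box c r : set mE) by exact: measurable_box.
have mb2 : measurable (box c (r / 2) : set mE) by exact: measurable_box.
pose I : mE -> R := fun x : mE => (M + L) * \1_(box c r : set mE) x.
pose J : mE -> R := fun x : mE => expR (- 2) ^+ N * \1_(box c (r / 2) : set mE) x.
have mI : measurable_fun [set: mE] I by apply: measurable_funM => //; exact: measurable_indic.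
have mJ : measurable_fun [set: mE] J by apply: measurable_funM => //; exact: measurable_indic.
have mSu : measurable_fun (Omega : set mE) (fun x => S t u x - u x).
  apply: measurable_funB; last by case: Lu.
  by case: (kernel_contraction hk p1 t0 Lu) => -[].
have nJ : Lnorm leb 2%:E (EFin \o J) = (expR (- 2) ^+ N * Num.sqrt (r ^+ N))%:E.
  have e0 : 0 <= expR (- 2 : R) ^+ N by rewrite exprn_ge0// expR_ge0.
  have r20 : 0 <= r / 2 by rewrite divr_ge0// ltW.
  have r22 : 0 <= (2 * (r / 2)) ^+ N by rewrite exprn_ge0// mulr_ge0.
  rewrite (Lnorm2_indic mb2 e0 r22 (lebesgue_rV_box c r20)).
  by rewrite mulrCA mulfV ?mulr1.
have nI : Lnorm leb 2%:E (EFin \o I) = ((M + L) * Num.sqrt ((2 * r) ^+ N))%:E.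
  have r22 : 0 <= (2 * r) ^+ N by rewrite exprn_ge0// mulr_ge0// ltW.
  exact: (Lnorm2_indic mb (addr_ge0 M0 L0) r22 (lebesgue_rV_box c (ltW r0))).
pose Su := (fun x => `|S t u x - u x|) \_ Omega.
have mSuO : measurable_fun [set: mE] Su.
  apply: mfun_restrict => //; exact: measurableT_comp.
have le1 : (Lnorm leb 2%:E (EFin \o J) <= Lnorm leb 2%:E (EFin \o (Su \+ I)%R))%E.
  apply: Lnorm2_ae_le => //; first exact: measurable_funD.
  apply: aeS2 HM HL => x HMx HLx.
  have Su0 : 0 <= Su x by rewrite /Su patchE; case: ifPn.
  have I0 : 0 <= I x by rewrite /I mulr_ge0 ?addr_ge0// indicE.
  rewrite [leRHS]ger0_norm ?addr_ge0//.
  rewrite /J indicE; have [xb|xb] := boolP (x \in _); last by rewrite mulr0 normr0 addr_ge0.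
  rewrite mulr1 ger0_norm ?exprn_ge0 ?expR_ge0//.
  rewrite inE in xb; apply: le_trans (tbump0_lower r0 xb) _.
  have xb' : box c r x.
    by move=> i; rewrite (le_trans (xb i))// ler_pdivrMr//; lra.
  rewrite /= /Su patchE mem_set; last exact: bO.
  rewrite /I indicE mem_set// mulr1 -/u.
  have := HLx xb'; have := HMx (bO _ xb'); rewrite -/u.
  move: (S t u x) (F x) (u x) => a b d.
  by rewrite !ler_norml; have := ler_norm (a - d); have := ler_norm (d - a);
    rewrite distrC; lra.
have := minkowski_EFin leb mSuO mI (ler1n R 2 : (1 <= 2)%R).
move=> /(le_trans le1); rewrite nJ nI => le2.
have le3 : (Lnorm leb 2%:E (EFin \o Su) <= (t * (N%:R * (r^-1 ^+ 2 * B) * Num.sqrt ((2 * r) ^+ N)))%:E)%E.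
  apply: le_trans (_ : norm_Lp Omega 2%:E (fun x => (S t u x - u x)%R) <= _)%E.
    apply: Lnorm2_ae_le => //; first exact: mfun_restrict.
    by apply: aeW => x; rewrite /Su !patchE; case: ifPn => // _; rewrite normr_id.
  by rewrite EFinM (le_trans nS)// lee_pmul2l.
have := le_trans le2 (leeD le3 (lexx _)).
rewrite -EFinD lee_fin exprMn sqrtrM ?exprn_ge0//.
have s0 : 0 < Num.sqrt (r ^+ N) by rewrite sqrtr_gt0 exprn_gt0.
move=> H; rewrite -(ler_pM2r s0); apply: le_trans H _; rewrite le_eqVlt; apply/orP; left; apply/eqP; ring.
Qed.

End semigroup.

(** * The gliding hump *)

Section gliding_hump.
Context {R : realType} {N : nat}.
Local Notation E := 'rV[R]_N.
Local Notation mE := 'rV[measurableTypeR R]_N.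
Local Notation leb := (lebesgue_rV R N).
Variables (Omega : set E).
Hypothesis oO : open Omega.

(** One weight [a j] controls both height and mass, so the sum is bounded in L^infty and L^1
    together, the two norms in which the error operator is estimated. *)
Lemma dominated_series (f : nat -> E -> R) (a : nat -> R) (rho A : R) :
  (forall j, 0 <= a j) -> 0 <= rho -> (forall n, series a n <= A) ->
  (forall j, measurable_fun [set: mE] (f j)) ->
  (forall j x, `|f j x| <= rho * a j) ->
  (forall j, (norm_Lp Omega 1%:E (f j) <= (a j)%:E)%E) ->
  exists F : E -> R, [/\ forall x, series (f ^~ x) @ \oo --> F x,
    forall x, `|F x| <= rho * A, Lp Omega 1%:E F &
    (norm_Lp Omega 1%:E F <= A%:E)%E].
Proof.
move=> a0 rho0 aA mf fa na.
have nser x n : series (fun j => `|f j x|) n <= rho * A.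
  apply: (@le_trans _ _ (rho * series a n)); last by rewrite ler_wpM2l.
  by rewrite /series /= mulr_sumr ler_sum.
have cser x : cvgn (series (f ^~ x)).
  apply: normed_cvg; apply: nondecreasing_is_cvgn.
    by apply: nondecreasing_series => n _ _; exact: normr_ge0.
  by exists (rho * A) => _ [n _ <-]; exact: nser.
have serA x n : `|series (f ^~ x) n| <= rho * A.
  by apply: le_trans (nser x n); exact: ler_norm_sum.
pose F x := limn (series (f ^~ x)).
have cF x : series (f ^~ x) @ \oo --> F x by exact: cser.
have mF : measurable_fun [set: mE] F.
  apply: (@measurable_fun_cvg _ _ _ _ (fun n (x : mE) => series (f ^~ x) n)).
    by move=> n; apply: measurable_sum => j; exact: mf.
  by move=> x _; exact: cF.
have FA x : `|F x| <= rho * A.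
  rewrite -(cvg_lim (@norm_hausdorff _ _) (cvg_norm (cF x))).
  apply: limr_le; first by apply/cvg_ex; exists `|F x|; exact: cvg_norm.
  by apply: nearW => n; exact: serA.
have nF : (norm_Lp Omega 1%:E F <= A%:E)%E.
  rewrite norm_L1E.
  apply: (@le_trans _ _ (\int[leb]_(x in Omega) (\sum_(j <oo) `|f j x|%:E))%E).
    apply: ge0_le_integral.
    - exact: measurable_open_rV.
    - by move=> x _.
    - apply: measurableT_comp => //; apply/measurable_EFinP.
      exact: measurable_funTS.
    - apply: ge0_emeasurable_sum => [j x _ _|j _]; first by rewrite lee_fin.
      by apply/measurable_EFinP/measurable_funTS; exact: measurableT_comp.
    - move=> x _.
      have cn : cvgn (series (fun j => `|f j x|)).
        apply: nondecreasing_is_cvgn.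
          by apply: nondecreasing_series => n _ _; exact: normr_ge0.
        by exists (rho * A) => _ [n _ <-]; exact: nser.
      rewrite /= (_ : (\sum_(j <oo) _)%E = (limn (series (fun j => `|f j x|)))%:E).
        by rewrite lee_fin; exact: lim_series_norm.
      rewrite -EFin_lim//; congr (limn _); apply/funext => n /=.
      by rewrite /= -sumEFin.
  rewrite integral_nneseries//; last first.
  - move=> j; apply/measurable_EFinP/measurable_funTS; exact: measurableT_comp.
  - exact: measurable_open_rV.
  apply: lime_le; first by apply: is_cvg_nneseries => j _ _; exact: integral_ge0.
  apply: nearW => n; apply: (@le_trans _ _ (\sum_(0 <= j < n) (a j)%:E)%E).
    by apply: lee_sum => j _; rewrite -norm_L1E.
  by rewrite sumEFin lee_fin; exact: aA.
exists F; split=> //; split; first exact: measurable_funTS.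
exact: le_lt_trans nF (ltry _).
Qed.

Lemma series_geometric_le (q : R) (m n : nat) : 0 < q -> q <= 2^-1 ->
  series (fun j => q ^+ (m + j)) n <= 2 * q ^+ m.
Proof.
move=> q0 q2; rewrite (_ : (fun j => q ^+ (m + j)) = geometric (q ^+ m) q); last first.
  by apply/funext => j; rewrite /= exprD.
have q1 : `|q| < 1 by rewrite gtr0_norm//; lra.
apply: le_trans (geometric_le_lim n (ltW (exprn_gt0 m q0)) q0 q1) _.
rewrite mulrC ler_wpM2r ?exprn_ge0 ?(ltW q0)// -[leRHS]invrK.
by rewrite lef_pV2 ?posrE ?invr_gt0//; lra.
Qed.

(* The signs are chosen one after the other: since [2 T xi = T (w + xi) - T (w - xi)],
   one of [T (w + xi)] and [T (w - xi)] is at least as large as [T xi]. *)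
Lemma gliding_hump (T : nat -> (E -> R) -> E -> R) (v : nat -> E -> R)
    (rho : nat -> R) (delta H q : R) :
  0 < q -> q <= 2^-1 -> 0 <= H -> 0 < delta -> 4 * H * q <= delta ->
  (forall n, 0 < rho n) -> (forall m n, (m <= n)%N -> rho n <= rho m) ->
  (forall n (a : R) u w x, Lp Omega 1%:E u -> Lp Omega 1%:E w -> Omega x ->
    T n (fun y => a * u y + w y) x = a * T n u x + T n w x) ->
  (forall n w (kappa : R), 0 <= kappa -> Lp Omega 1%:E w ->
    (forall x, `|w x| <= kappa * rho n) -> (norm_Lp Omega 1%:E w <= kappa%:E)%E ->
    {ae leb, forall x, Omega x -> `|T n w x| <= H * (kappa * rho n)}) ->
  (forall n, measurable_fun [set: mE] (v n)) ->
  (forall n x, `|v n x| <= rho n) ->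
  (forall n, (norm_Lp Omega 1%:E (v n) <= 1%:E)%E) ->
  (forall n (M : R), 0 <= M -> {ae leb, forall x, Omega x -> `|T n (v n) x| <= M} ->
    delta * rho n <= M) ->
  exists U, [/\ Lp Omega 1%:E U, (norm_Lp Omega 1%:E U <= 2%:E)%E &
    forall n (M : R), 0 <= M -> {ae leb, forall x, Omega x -> `|T n U x| <= M} ->
    delta / 2 * (q ^+ n * rho n) <= M].
Proof.
move=> q0 q2 H0 d0 Hq rho0 rhod Tlin Tbd mv vrho v1 Tlow.
(* [good n w s]: adding the n-th hump with sign [s] to [w] leaves at least the size that this hump
   has alone. *)
pose good n (w : E -> R) (s : R) := forall M : R, 0 <= M ->
  {ae leb, forall x, Omega x -> `|T n (fun y => (s * q ^+ n) * v n y + w y) x| <= M} ->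
  delta * (q ^+ n * rho n) <= M.
pose sg n w : R := if `[< good n w 1 >] then 1 else -1.
(* Each sign depends on the partial sum before it, so signs and partial sums are built by one
   recursion. *)
pose W := fix W n : E -> R := if n is n'.+1 then
  (fun y => (sg n' (W n') * q ^+ n') * v n' y + W n' y) else (fun=> 0).
pose f n (x : E) := sg n (W n) * q ^+ n * v n x.
have sg1 n w : `|sg n w| = 1 by rewrite /sg; case: ifPn => _; rewrite ?normrN normr1.
have Lv n : Lp Omega 1%:E (v n).
  by split; [exact: measurable_funTS|exact: le_lt_trans (v1 n) (ltry _)].
have mff n : measurable_fun [set: mE] (f n) by exact: measurable_funM.
have nf n : (norm_Lp Omega 1%:E (f n) <= (q ^+ n)%:E)%E.
  rewrite norm_L1E; under eq_integral do rewrite /f EFinM abseM.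
  rewrite ge0_integralZl//; last 2 first.
  - exact: measurable_open_rV.
  - apply: measurableT_comp => //; apply/measurable_EFinP; exact: measurable_funTS.
  rewrite -norm_L1E /= normrM sg1 mul1r ger0_norm ?exprn_ge0 ?(ltW q0)//.
  by rewrite -[leRHS]mule1 lee_pmul2l// lte_fin exprn_gt0.
have ff n x : `|f n x| <= q ^+ n * rho n.
  rewrite /f !normrM sg1 mul1r ger0_norm ?exprn_ge0 ?(ltW q0)//.
  by rewrite ler_wpM2l ?exprn_ge0 ?(ltW q0).
have Lf n : Lp Omega 1%:E (f n).
  by split; [exact: measurable_funTS|exact: le_lt_trans (nf n) (ltry _)].
have LW n : Lp Omega 1%:E (W n).
  elim: n => [|n IH].
    by split; [exact: measurable_cst|rewrite norm_Lp0 ?ltry].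
  by apply: LpD => //; exact: Lf.
have goodsg n : good n (W n) (sg n (W n)).
  rewrite /sg; case: asboolP => // /existsNP[M1 /not_implyP[M10 /not_implyP[h1 /negP]]].
  rewrite -ltNge => lt1 M2 M20 h2; rewrite leNgt; apply/negP => lt2.
  have qn0 : 0 < q ^+ n by rewrite exprn_gt0.
  have := Tlow n ((M1 + M2) / (2 * q ^+ n)).
  have /[swap]/[apply] : 0 <= (M1 + M2) / (2 * q ^+ n) by
    rewrite divr_ge0 ?addr_ge0// mulr_ge0// ltW.
  have /[swap]/[apply] : {ae leb, forall x, Omega x ->
      `|T n (v n) x| <= (M1 + M2) / (2 * q ^+ n)}.
    apply: aeS2 h1 h2 => x h1 h2 xO; rewrite ler_pdivlMr ?mulr_gt0//.
    have := h1 xO; have := h2 xO; rewrite !Tlin// mul1r mulN1r.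
    move: (T n (v n) x) (T n (W n) x) => a b; rewrite !mulNr => h3 h4.
    rewrite -[2 * _]gtr0_norm ?mulr_gt0// -normrM.
    rewrite (_ : a * _ = (q ^+ n * a + b) - (- (q ^+ n * a) + b)); last by ring.
    by rewrite (le_trans (ler_normB _ _))// lerD.
  rewrite ler_pdivlMr ?mulr_gt0// => h.
  have : delta * (q ^+ n * rho n) * 2 < delta * (q ^+ n * rho n) * 2.
    by apply: le_lt_trans (_ : M1 + M2 < _); lra.
  by rewrite ltxx.
have WE n x : W n x = series (f ^~ x) n.
  elim: n => [|n IH]; first by rewrite /series /= big_geq.
  by rewrite seriesSr -IH addrC.
(* The height is measured by [rho m.-1]: the tail from [n.+1] is used at time index [n], where the
   bound on [T n] is stated with [rho n]. *)
have tail m : exists F : E -> R, [/\ forall x, series (fun j => f (m + j)%N x) @ \oo --> F x,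
    forall x, `|F x| <= rho m.-1 * (2 * q ^+ m), Lp Omega 1%:E F &
    (norm_Lp Omega 1%:E F <= (2 * q ^+ m)%:E)%E].
  apply: (@dominated_series _ (fun j => q ^+ (m + j))) => //.
  - by move=> j; rewrite exprn_ge0// ltW.
  - exact: ltW.
  - by move=> n; exact: series_geometric_le.
  - move=> j x; rewrite (le_trans (ff _ _))// mulrC ler_wpM2r ?exprn_ge0 ?(ltW q0)//.
    by rewrite rhod// (leq_trans (leq_pred _))// leq_addr.
have [U [cU _ LU nU]] := tail 0%N.
exists U; split=> //; first by rewrite expr0 mulr1 in nU.
move=> n M M0 HM.
have [F [cF FA LF nF]] := tail n.+1.
have UF x : W n.+1 x = (-1) * F x + U x.
  suff : U x = W n.+1 x + F x by move=> ->; ring.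
  have h : series (f ^~ x) (k + n.+1)%N @[k --> \oo] --> U x.
    by have := cU x; rewrite (cvg_shiftn n.+1); apply.
  apply: (cvg_unique (@Rhausdorff R) h).
  rewrite (_ : (fun k => _) = fun k => W n.+1 x + series (fun j => f (n.+1 + j)%N x) k).
    by apply: cvgD; [exact: cvg_cst|exact: cF].
  apply/funext => k; rewrite WE /series /= (@big_cat_nat _ _ _ n.+1)//= ?leq_addl//.
  congr (_ + _); rewrite -{1}[n.+1]add0n big_addn addnK.
  by apply: eq_bigr => j _; rewrite addnC.
have K0 : 0 <= 2 * q ^+ n.+1 by rewrite mulr_ge0// exprn_ge0// ltW.
have FA' x : `|F x| <= 2 * q ^+ n.+1 * rho n by rewrite mulrC; exact: FA.
have TF := Tbd n F _ K0 LF FA' nF.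
have : delta * (q ^+ n * rho n) <= M + H * (2 * q ^+ n.+1 * rho n).
  apply: (goodsg n).
    by rewrite addr_ge0// mulr_ge0// mulr_ge0// ltW.
  apply: aeS2 HM TF => x h1 h2 xO.
  rewrite -[X in T n X x]/(W n.+1) (_ : W n.+1 = fun x => (-1) * F x + U x); last first.
    by apply/funext => y; exact: UF.
  rewrite Tlin// mulN1r (le_trans (ler_normD _ _))// normrN addrC lerD//.
  - exact: h1.
  - exact: h2.
(* The tail costs [2 * H * q] times [q ^+ n * rho n], which is at most half of [delta] times the
   same quantity. *)
have : 4 * H * q * (q ^+ n * rho n) <= delta * (q ^+ n * rho n).
  by rewrite ler_wpM2r// mulr_ge0 ?exprn_ge0 ?ltW.
rewrite exprS; lra.
Qed.

End gliding_hump.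

(** * The error operator *)

Lemma powR_sqr_half (R : realType) (r : R) (n : nat) : 0 <= r ->
  (r ^+ 2) `^ (n%:R / 2) = r ^+ n.
Proof.
by move=> r0; rewrite -(powR_mulrn 2 r0) -powRrM mulrCA mulfV// mulr1 powR_mulrn.
Qed.

Section profile.
Context {R : realType} {N : nat}.
Local Notation E := 'rV[R]_N.
Local Notation mE := 'rV[measurableTypeR R]_N.
Local Notation leb := (lebesgue_rV R N).
Variables (Omega : set E) (theta : E -> R) (k : E -> E -> R -> R) (Phi : E -> R).
Hypothesis oO : open Omega.
Hypothesis hk : heat_kernel Omega theta k.
Hypothesis hPhi : asymptotic_profile Omega (kernel_operator Omega k) Phi.
Local Notation S := (kernel_operator Omega k).

(** The norm of exponent [+oo] unfolds to an essential supremum only once the whole space is known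
    to have positive measure. *)
Lemma lebesgue_rV_setT_gt0 : (0 < leb [set: mE])%E.
Proof.
apply: (@lt_le_trans _ _ (leb (box (0 : E) 2^-1))).
  apply: (@lt_le_trans _ _ 1%:E); first by rewrite lte_fin.
  rewrite le_eqVlt; apply/orP; left; apply/eqP; apply: esym.
  transitivity ((2 * 2^-1 : R) ^+ N)%:E; last by rewrite mulfV ?expr1n.
  by apply: lebesgue_rV_box; rewrite invr_ge0.
by apply: le_measure; rewrite ?inE//; exact: measurable_box.
Qed.

Lemma norm_Linfty_leP (f : E -> R) (c : R) : 0 <= c ->
  (norm_Lp Omega +oo%E f <= c%:E)%E <-> {ae leb, forall x, Omega x -> `|f x| <= c}.
Proof.
move=> c0; rewrite /norm_Lp unlock lebesgue_rV_setT_gt0; split=> [/ess_supP|] H.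
  apply: aeS H => x; rewrite /= patchE lee_fin => h xO.
  by rewrite mem_set in h.
apply/ess_supP; apply: aeS H => x h; rewrite /= patchE lee_fin.
by case: ifPn => [|_]; rewrite ?normr0// inE.
Qed.

Lemma Lp_infty_cst1 : Lp Omega +oo%E (cst 1).
Proof.
split; first exact: measurable_cst.
apply: le_lt_trans (ltry 1); apply/norm_Linfty_leP => //.
by apply: aeW => x _; rewrite normr1.
Qed.

(** Integer times, shifted by one to stay positive, make [Phi] the limit of a sequence:
    measurability passes to it, and countably many exceptional null sets still form a null set. *)
Lemma profile_cvg (x : E) : Omega x -> S n.+1%:R (cst 1) x @[n --> \oo] --> Phi x.
Proof.
move=> xO; rewrite (cvg_shiftS (fun n => S n%:R (cst 1) x)).
exact: (cvg_comp _ _ cvgr_idn (hPhi xO)).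
Qed.

Lemma measurable_profile : @measurable_fun _ _ mE R Omega Phi.
Proof.
apply: (@measurable_fun_cvg _ _ _ _ (fun n x => S n.+1%:R (cst 1) x)); last exact: profile_cvg.
by move=> n; case: (kernel_contraction hk (leey _) (ltr0Sn _ n) Lp_infty_cst1) => -[].
Qed.

Lemma profile_bound : {ae leb, forall x, Omega x -> 0 <= Phi x <= 1}.
Proof.
have : {ae leb, forall x, forall n, Omega x -> `|S n.+1%:R (cst 1) x| <= 1}.
  apply: ae_foralln => n; apply/norm_Linfty_leP => //.
  apply: le_trans (kernel_contraction hk (leey _) (ltr0Sn _ n) Lp_infty_cst1).2 _.
  by apply/norm_Linfty_leP => //; apply: aeW => x _; rewrite normr1.
apply: aeS => x H xO; apply/andP; split.
  apply: (@cvgr_to_ge _ _ _ _ _ _ _ (profile_cvg xO)); apply: nearW => n.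
  apply: Rintegral_ge0 => y yO; rewrite mulr1 ltW//.
  exact: (kernel_positive hk).
apply: (@cvgr_to_le _ _ _ _ _ _ _ (profile_cvg xO)); apply: nearW => n.
by rewrite (le_trans (ler_norm _))// H.
Qed.

Lemma integrable_profile (u : E -> R) : Lp Omega 1%:E u ->
  leb.-integrable Omega (fun x => (Phi x * u x)%:E) /\
  (`| \int[leb]_(x in Omega) (Phi x * u x) |%:E <= norm_Lp Omega 1%:E u)%E.
Proof.
move=> Lu; have mO := measurable_open_rV oO.
have [mu fu] := Lu.
have mPu : @measurable_fun _ _ mE R Omega (fun x => Phi x * u x).
  by apply: measurable_funM => //; exact: measurable_profile.
have le : (\int[leb]_(x in Omega) `|(Phi x * u x)%:E| <= norm_Lp Omega 1%:E u)%E.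
  rewrite norm_L1E; apply: ae_ge0_le_integral => //.
  - by apply: measurableT_comp => //; apply/measurable_EFinP.
  - by apply: measurableT_comp => //; apply/measurable_EFinP.
  - apply: aeS profile_bound => x H xO; rewrite lee_fin normrM.
    have /andP[P0 P1] := H xO; by rewrite ger0_norm// ler_piMl.
have I : leb.-integrable Omega (fun x => (Phi x * u x)%:E).
  apply/integrableP; split; first exact/measurable_EFinP.
  exact: le_lt_trans le fu.
split=> //; apply: le_trans le.
rewrite EFin_normr_Rintegral//; apply: le_abse_integral => //.
exact/measurable_EFinP.
Qed.

Definition profile_error (t : R) (u : E -> R) (x : E) : R :=
  S t u x - (\int[leb]_(x in Omega) (Phi x * u x)) * Phi x * gaussian x t.

Lemma profile_error_linear (t a : R) (u v : E -> R) (x : E) : 0 < t ->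
  Lp Omega 1%:E u -> Lp Omega 1%:E v -> Omega x ->
  profile_error t (fun y => a * u y + v y) x = a * profile_error t u x + profile_error t v x.
Proof.
move=> t0 Lu Lv xO; rewrite /profile_error (kernel_operator_linear oO hk _ (lexx 1%:E))//.
have mO := measurable_open_rV oO.
have [iu _] := integrable_profile Lu; have [iv _] := integrable_profile Lv.
rewrite (_ : \int[leb]_(x in Omega) (Phi x * (a * u x + v x)) =
  a * \int[leb]_(x in Omega) (Phi x * u x) + \int[leb]_(x in Omega) (Phi x * v x)).
  by ring.
rewrite -RintegralZl// -RintegralD//.
- by apply: eq_Rintegral => y _; ring.
- by rewrite (_ : EFin \o _ = fun y => a%:E * (Phi y * u y)%:E)%E//; exact: integrableZl.
Qed.

Lemma gaussian_ge0 (x : E) (t : R) : 0 <= gaussian x t.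
Proof. by rewrite /gaussian divr_ge0 ?expR_ge0 ?powR_ge0. Qed.

Lemma gaussian_le (x : E) (t : R) : 0 < t -> gaussian x t <= ((4 * pi * t) `^ (N%:R / 2))^-1.
Proof.
move=> t0; rewrite /gaussian ler_piMl ?invr_ge0 ?powR_ge0//.
by rewrite expR_le1 oppr_le0 divr_ge0 ?sqr_ge0// mulr_ge0// ltW.
Qed.

(** The semigroup term keeps the height [b] by contraction in L^infty; the other term is at most the
    mass times the maximum of the Gaussian, as [Phi] lies between 0 and 1 almost everywhere. *)
Lemma profile_error_le (t b kappa : R) (w : E -> R) : 0 < t -> 0 <= b ->
  Lp Omega 1%:E w -> {ae leb, forall x, Omega x -> `|w x| <= b} ->
  (norm_Lp Omega 1%:E w <= kappa%:E)%E ->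
  {ae leb, forall x, Omega x ->
    `|profile_error t w x| <= b + kappa * ((4 * pi * t) `^ (N%:R / 2))^-1}.
Proof.
move=> t0 b0 Lw wb wk.
have nw : (norm_Lp Omega +oo%E w <= b%:E)%E by apply/norm_Linfty_leP.
have Lwy : Lp Omega +oo%E w by split; [case: Lw|exact: le_lt_trans nw (ltry _)].
have /norm_Linfty_leP := le_trans (kernel_contraction hk (leey _) t0 Lwy).2 nw.
move=> /(_ b0); apply: aeS2 profile_bound => x HP HS xO.
rewrite /profile_error (le_trans (ler_normB _ _))// lerD ?HS//.
have /andP[P0 P1] := HP xO.
rewrite -mulrA normrM; apply: ler_pM => //.
  by have := le_trans (integrable_profile Lw).2 wk; rewrite lee_fin.
rewrite ger0_norm ?mulr_ge0 ?gaussian_ge0//.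
  by apply: le_trans (gaussian_le x t0); rewrite ler_piMl ?gaussian_ge0.
by rewrite invr_ge0 powR_ge0.
Qed.

Lemma norm_L1_tbump (c : E) (r : R) : 0 < r ->
  (norm_Lp Omega 1%:E (tbump c r (fun=> 0%N)) <= ((2 * r) ^+ N)%:E)%E.
Proof.
move=> r0; rewrite norm_L1E.
have mb : measurable (box c r : set mE) by exact: measurable_box.
apply: (@le_trans _ _ (\int[leb]_(x in Omega) (\1_(box c r : set mE) x)%:E)%E).
  apply: ge0_le_integral => //.
  - exact: measurable_open_rV.
  - apply: measurableT_comp => //; apply/measurable_EFinP.
    by apply: measurable_funTS; exact: measurable_tbump.
  - by apply/measurable_EFinP; exact: measurable_indic.
  - move=> x _; rewrite lee_fin ger0_norm ?tbump0_ge0// indicE.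
    have [xb|xb] := boolP (x \in _); first exact: tbump0_le1.
    by rewrite tbump_out// => /mem_set; rewrite (negbTE xb).
rewrite integral_indic//; last exact: measurable_open_rV.
apply: (@le_trans _ _ (leb (box c r))).
  apply: le_measure; rewrite ?inE//.
  by apply: measurableI => //; exact: measurable_open_rV.
by rewrite le_eqVlt; apply/orP; left; apply/eqP; apply: lebesgue_rV_box; rewrite ltW.
Qed.

Lemma Lp1_tbump (c : E) (r : R) : 0 < r -> Lp Omega 1%:E (tbump c r (fun=> 0%N)).
Proof.
move=> r0; split; first by apply: measurable_funTS; exact: measurable_tbump.
exact: le_lt_trans (norm_L1_tbump c r0) (ltry _).
Qed.

Lemma profile_error_scale (t a : R) (u : E -> R) (x : E) : 0 < t ->
  Lp Omega 1%:E u -> Omega x ->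
  profile_error t (fun y => a * u y) x = a * profile_error t u x.
Proof.
move=> t0 Lu xO.
have L0 : Lp Omega 1%:E (fun=> 0).
  by split; [exact: measurable_cst|rewrite norm_Lp0 ?ltry].
(* Coefficient -1 and two zero functions show that the operator sends 0 to 0. *)
have := profile_error_linear (-1) t0 L0 L0 xO.
rewrite (_ : (fun y : E => -1 * 0 + 0) = fun=> 0); last by apply/funext => y; ring.
rewrite mulN1r addNr => e0.
have := profile_error_linear a t0 Lu L0 xO; rewrite e0 addr0 => <-.
by congr (profile_error _ _ _); apply/funext => y; rewrite addr0.
Qed.

Lemma norm_L1Z (a : R) (u : E -> R) : @measurable_fun _ _ mE R Omega u ->
  norm_Lp Omega 1%:E (fun x => a * u x) = (`|a|%:E * norm_Lp Omega 1%:E u)%E.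
Proof.
move=> mu; rewrite !norm_L1E; under eq_integral do rewrite EFinM abseM.
rewrite ge0_integralZl//; first exact: measurable_open_rV.
by apply: measurableT_comp => //; exact/measurable_EFinP.
Qed.

Lemma norm_L1_eq0 (u : E -> R) : Lp Omega 1%:E u -> norm_Lp Omega 1%:E u = 0%E ->
  {ae leb, forall x, Omega x -> u x = 0}.
Proof.
move=> [mu _] u0.
have mu' : measurable_fun [set: mE] (EFin \o u \_ Omega).
  by apply/measurable_EFinP; exact: mfun_restrict.
have := Lnorm_eq0_eq0 mu' (lte01 : (0 < 1%:E)%E) u0.
apply: aeS => x h xO; have /= := h Logic.I.
by rewrite patchE mem_set// => -[].
Qed.

(* The bump of width [r] centred at distance [K r] from the origin still has
   height of order [1] at time [t = tau r ^ 2], whereas the Gaussian is smaller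
   than [r ^ (- N)] there by the factor [exp (- (K - 1) ^ 2 / (4 tau))]. *)
Lemma profile_error_bump_lower (i0 : 'I_N) : exists tau K delta : R,
  [/\ 0 < tau, 2 <= K, 0 < delta &
  forall r M : R, 0 < r -> 0 <= M -> box (K * r *: delta_mx 0 i0) r `<=` Omega ->
  {ae leb, forall x, Omega x ->
    `|profile_error (tau * r ^+ 2) (tbump (K * r *: delta_mx 0 i0) r (fun=> 0%N)) x| <= M} ->
  delta <= M].
Proof.
have [B HB] := @bump_bounded R 2.
have B0 : 0 <= B by rewrite (le_trans _ (HB 0)).
set e : R := expR (- 2) ^+ N; have e0 : 0 < e by rewrite exprn_gt0// expR_gt0.
set s : R := Num.sqrt (2 ^+ N); have s0 : 0 < s by rewrite sqrtr_gt0 exprn_gt0.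
have NB0 : 0 <= N%:R * B by rewrite mulr_ge0.
have [tau [tau0 h1]] : exists tau : R, 0 < tau /\ tau * (N%:R * B) <= e / (4 * s).
  have NB1 : 0 < N%:R * B + 1 by rewrite ltr_wpDl.
  exists (e / (4 * s) / (N%:R * B + 1)); split.
    by rewrite divr_gt0// divr_gt0// mulr_gt0.
  rewrite -mulrA ler_piMr ?divr_ge0 ?mulr_ge0 ?(ltW s0) ?(ltW e0)//.
  by rewrite mulrC ler_pdivrMr// mul1r lerDl.
pose P := (4 * pi * tau) `^ (N%:R / 2).
have pi0 := pi_gt0 R.
have P0 : 0 < P by rewrite powR_gt0// mulr_gt0// mulr_gt0.
have [K [K2 HK]] : exists K : R, 2 <= K /\
    2 ^+ N * (expR (- ((K - 1) ^+ 2 / (4 * tau))) / P) <= e / (4 * s).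
  pose eta := e / (4 * s) * P / 2 ^+ N.
  have eta0 : 0 < eta by rewrite divr_gt0 ?exprn_gt0// mulr_gt0// divr_gt0// mulr_gt0.
  have z0 : 0 < 4 * tau / eta by rewrite divr_gt0// mulr_gt0.
  (* With [z = 4 tau / eta], [y = (1 + z)^2 / (4 tau) >= z / (4 tau) = 1 / eta], and
     [exp(-y) <= 1 / y]. *)
  exists (2 + 4 * tau / eta); split; first by rewrite lerDl ltW.
  set y := (_ ^+ 2 / _).
  have hy : eta^-1 <= y.
    have t40 : 0 < (4 * tau)^-1 by rewrite invr_gt0 mulr_gt0.
    rewrite (_ : eta^-1 = 4 * tau / eta * (4 * tau)^-1); last by field; rewrite !gt_eqF.
    by rewrite /y ler_pM2r//; move: z0; set z := 4 * tau / eta; nra.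
  have hexp : expR (- y) <= eta.
    rewrite expRN -[leRHS]invrK lef_pV2 ?posrE ?invr_gt0 ?expR_gt0//.
    by rewrite (le_trans hy)// (le_trans _ (expR_ge1Dx y))// lerDr.
  by rewrite mulrA ler_pdivrMr// mulrC -ler_pdivlMr// ?exprn_gt0//.
(* The lower bound reads [e / s <= tau * (N * B) + M + L]; the generator and Gaussian terms take at
   most [e / (4 * s)] each, leaving [e / (2 * s)] for [M]. *)
exists tau, K, (e / (2 * s)); split=> //; first by rewrite divr_gt0// mulr_gt0.
move=> r M r0 M0 bO HM.
set c := K * r *: delta_mx 0 i0 in bO HM *.
set t := tau * r ^+ 2 in HM.
have t0 : 0 < t by rewrite mulr_gt0// exprn_gt0.
set u := tbump c r _ in HM.
pose m := \int[leb]_(x in Omega) (Phi x * u x).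
pose L := 2 ^+ N * (expR (- ((K - 1) ^+ 2 / (4 * tau))) / P).
have L0 : 0 <= L by rewrite mulr_ge0 ?exprn_ge0// divr_ge0 ?expR_ge0// ltW.
have mr : `|m| <= (2 * r) ^+ N.
  rewrite -lee_fin; apply: le_trans (integrable_profile (Lp1_tbump c r0)).2 _.
  exact: norm_L1_tbump.
have G x : box c r x -> gaussian x t <= expR (- ((K - 1) ^+ 2 / (4 * tau))) / P / r ^+ N.
  move=> xb; rewrite /gaussian.
  have -> : (4 * pi * t) `^ (N%:R / 2) = P * r ^+ N.
    have A : 0 <= 4 * pi * tau.
      by rewrite mulr_ge0 ?(ltW tau0)// mulr_ge0 ?(ltW pi0).
    rewrite /t mulrA (powRM _ A (sqr_ge0 r)); congr (_ * _).
    exact/powR_sqr_half/ltW.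
  rewrite -[leRHS]mulrA -invfM ler_wpM2r ?invr_ge0 ?mulr_ge0 ?exprn_ge0 ?(ltW P0) ?(ltW r0)//.
  rewrite ler_expR lerN2 ler_pdivlMr ?mulr_gt0//.
  rewrite (_ : (K - 1) ^+ 2 / (4 * tau) * (4 * t) = ((K - 1) * r) ^+ 2); last first.
    by rewrite /t exprMn; field; rewrite gt_eqF.
  have x0 : (K - 1) * r <= x ord0 i0.
    have := xb i0; rewrite /c !mxE !eqxx mulr1 ler_distl => /andP[+ _]; lra.
  rewrite /enorm sqr_sqrtr; last by apply: sumr_ge0 => i _; exact: sqr_ge0.
  rewrite (bigD1 i0)//= ler_wpDr//; first by apply: sumr_ge0 => i _; exact: sqr_ge0.
  rewrite lerXn2r ?nnegrE//.
  - by rewrite mulr_ge0//; lra.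
  - by apply: le_trans x0; rewrite mulr_ge0//; lra.
have HF : {ae leb, forall x, box c r x -> `|m * Phi x * gaussian x t| <= L}.
  apply: aeS profile_bound => x HP xb.
  have /andP[P00 P1] := HP (bO _ xb).
  have g0 := gaussian_ge0 x t.
  rewrite normrM normrM (ger0_norm P00) (ger0_norm g0) -mulrA.
  (* The mass contributes [(2r)^N] and the Gaussian [r^(-N)], so [L] is independent of the scale. *)
  apply: (@le_trans _ _ ((2 * r) ^+ N * (expR (- ((K - 1) ^+ 2 / (4 * tau))) / P / r ^+ N))).
    apply: ler_pM => //; first by rewrite mulr_ge0.
    by apply: le_trans (G x xb); rewrite ler_piMl.
  rewrite exprMn /L le_eqVlt; apply/orP; left; apply/eqP.
  by field; rewrite !gt_eqF ?exprn_gt0.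
have := bump_lower_bound oO hk r0 bO t0 M0 L0 HB HM HF.
rewrite -/e -/s.
have -> : t * (N%:R * (r^-1 ^+ 2 * B)) = tau * (N%:R * B).
  by rewrite /t; field; rewrite gt_eqF.
rewrite -ler_pdivrMl//.
have -> : s^-1 * e = e / (2 * s) + e / (4 * s) + e / (4 * s) by field; rewrite gt_eqF.
move: HK h1; rewrite -/L; lra.
Qed.

End profile.

(** * Choice of the scales, normalisation and conclusion *)

Lemma coord_le_norm (R : realType) (N : nat) (x : 'rV[R]_N) (i : 'I_N) :
  `|x ord0 i| <= `|x|.
Proof.
rewrite [leRHS]mx_normE -[leLHS]nngE num_le.
exact: (le_bigmax _ (fun j : 'I_1 * 'I_N => `|x j.1 j.2|%:nng) (ord0, i)).
Qed.

Theorem theorem4p7 (R : realType) (N : nat) (hN : (0 < N)%N)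
    (C : set 'rV[R]_N) (hC : exterior_domain C)
    (g : R -> R)
    (g_range : forall t, 0 <= t -> 0 < g t <= 1)
    (g_decr : forall s t, 0 <= s -> s <= t -> g t <= g s)
    (g_cont : {within `[0, +oo[, continuous g})
    (g_lim : g t @[t --> +oo] --> 0)
    (theta : 'rV[R]_N -> R) (htheta : boundary_parameter (~` C) theta)
    (k : 'rV[R]_N -> 'rV[R]_N -> R -> R) (hk : heat_kernel (~` C) theta k)
    (Phi : 'rV[R]_N -> R)
    (hPhi : asymptotic_profile (~` C) (kernel_operator (~` C) k) Phi) :
  exists u0 : 'rV[R]_N -> R, exists t : nat -> R,
    let m := \int[lebesgue_rV R N]_(x in ~` C) (Phi x * u0 x) in
    [/\ Lp (~` C) 1%:E u0,
        norm_Lp (~` C) 1%:E u0 = 1%:E,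
        (forall n, 0 < t n),
        t n @[n --> \oo] --> +oo &
        forall n, ((g (t n))%:E <=
          (t n `^ (N%:R / 2))%:E *
          norm_Lp (~` C) +oo
            (fun x => (kernel_operator (~` C) k (t n) u0 x
                       - m * Phi x * gaussian x (t n))%R))%E].
Proof.
have cC := hole_compact hC.
have oO : open (~` C).
  by apply: closed_openC; apply: compact_closed => //; exact: norm_hausdorff.
have [b Cb] : exists b : R, forall x, C x -> `|x| <= b.
  have [b [_ Hb]] := compact_bounded cC; exists (b + 1) => x Cx.
  by apply: Hb => //; rewrite ltrDl.
pose i0 := Ordinal hN.
have [tau [K [delta [tau0 K2 delta0 low]]]] := profile_error_bump_lower oO hk hPhi i0.
pose P := (4 * pi * tau) `^ (N%:R / 2).
pose Q := tau `^ (N%:R / 2).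
have P0 : 0 < P by rewrite powR_gt0// !mulr_gt0// pi_gt0.
have Q0 : 0 < Q by exact: powR_gt0.
(* With [rho = (2r)^(-N)] and [(4 pi t)^(N/2) = P r^N], height [kappa * rho] and mass [kappa] give
   an error of at most [kappa * rho + kappa / (P r^N) = H * (kappa * rho)]. *)
pose H := 1 + 2 ^+ N / P.
have H0 : 0 < H by rewrite addr_gt0// divr_gt0// exprn_gt0.
pose q := Num.min 2^-1 (delta / (4 * H)).
have q0 : 0 < q by rewrite lt_min invr_gt0 divr_gt0 ?mulr_gt0// ltr0n.
have q2 : q <= 2^-1 by rewrite ge_min lexx.
have qH : 4 * H * q <= delta.
  by rewrite mulrC -ler_pdivlMr ?mulr_gt0// ge_min lexx orbT.
(* Calibrated for the final contradiction: [g(t_n) < eps n] says that [2 * (g(t_n) * 2^N / Q)] is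
   below the guaranteed [delta / 2 * q^n]. *)
pose eps n := delta * q ^+ n * Q / (4 * 2 ^+ N).
have eps0 n : 0 < eps n by rewrite divr_gt0 ?mulr_gt0 ?exprn_gt0.
have /choice[Z HZ] : forall n, exists Z : R, forall t, Z < t -> g t < eps n.
  move=> n; have := cvgr_lt _ g_lim _ (eps0 n).
  by move=> [Z [_ HZ]]; exists Z.
(* [1 + |b|] keeps the cubes off the hole, [n] drives [t_n] to infinity, and the last term puts
   [t_n] beyond [Z n]. A sum over all earlier thresholds makes [r] monotone; as [r n >= 1],
   [t_n >= tau * r n]. *)
pose r n : R := 1 + `|b| + n%:R + \sum_(i < n.+1) `|Z i| / tau.
have Zt0 i : 0 <= `|Z i| / tau by rewrite divr_ge0// ltW.
have r1 n : 1 + `|b| + n%:R <= r n by rewrite lerDl sumr_ge0.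
have r0 n : 0 < r n.
  by apply: lt_le_trans (r1 n); rewrite ltr_wpDr// ltr_wpDr.
have r_mono m n : (m <= n)%N -> r m <= r n.
  move=> mn; rewrite lerD//; first by rewrite lerD2l ler_nat.
  rewrite -(subnKC mn) -addSn big_split_ord /= lerDl.
  exact: sumr_ge0.
pose t n := tau * r n ^+ 2.
have t0 n : 0 < t n by rewrite mulr_gt0// exprn_gt0.
have rt n : tau * r n <= t n.
  rewrite ler_pM2l// expr2 ler_peMr ?(ltW (r0 n))//.
  by apply: le_trans (r1 n); rewrite -addrA lerDl addr_ge0.
have Zt n : Z n < t n.
  apply: lt_le_trans (rt n).
  rewrite -ltr_pdivrMl// mulrC.
  apply: (@lt_le_trans _ _ (1 + `|Z n| / tau)).
    by rewrite ltr_pwDl// ler_wpM2r ?invr_ge0 ?(ltW tau0)// ler_norm.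
  rewrite /r big_ord_recr /= addrA lerD2r -!addrA lerDl !addr_ge0//.
  exact: sumr_ge0.
have gt n : g (t n) < eps n by exact: HZ.
pose rho n := ((2 * r n) ^+ N)^-1.
have rho0 n : 0 < rho n by rewrite invr_gt0 exprn_gt0// mulr_gt0.
have rhod m n : (m <= n)%N -> rho n <= rho m.
  move=> mn; rewrite lef_pV2 ?posrE ?exprn_gt0 ?mulr_gt0//.
  by rewrite lerXn2r ?nnegrE ?mulr_ge0 ?ler_pM2l ?(ltW (r0 _))// r_mono.
have powt c n : 0 < c -> (c * t n) `^ (N%:R / 2) = (c * tau) `^ (N%:R / 2) * r n ^+ N.
  move=> c0; rewrite /t mulrA powRM ?sqr_ge0//; last by rewrite mulr_ge0 ?ltW.
  by rewrite powR_sqr_half// ltW.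
pose c n : 'rV[R]_N := K * r n *: delta_mx 0 i0.
have bO n : box (c n) (r n) `<=` ~` C.
  (* The coordinate along [i0] is at least [(K - 1) * r n >= r n > b] on the cube. *)
  move=> x xb /Cb; apply/negP; rewrite -ltNge.
  apply: (@lt_le_trans _ _ (r n)).
    apply: lt_le_trans (r1 n); rewrite -addrA addrCA.
    by rewrite (le_lt_trans (ler_norm b))// ltrDl ltr_pwDl.
  apply: (@le_trans _ _ `|x ord0 i0|); last exact: coord_le_norm.
  have := xb i0; rewrite /c !mxE !eqxx mulr1 ler_distl => /andP[h _].
  apply: le_trans (ler_norm _); have := r0 n; nra.
pose u n := tbump (c n) (r n) (fun=> 0%N).
pose v n x := rho n * u n x.
pose T n := profile_error (~` C) k Phi (t n).
have mu n : measurable_fun [set: 'rV[measurableTypeR R]_N] (u n) by exact: measurable_tbump.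
have Lu n : Lp (~` C) 1%:E (u n) by exact: Lp1_tbump.
have Tbd n w kappa : 0 <= kappa -> Lp (~` C) 1%:E w ->
    {ae lebesgue_rV R N, forall x, (~` C) x -> `|w x| <= kappa * rho n} ->
    (norm_Lp (~` C) 1%:E w <= kappa%:E)%E ->
    {ae lebesgue_rV R N, forall x, (~` C) x -> `|T n w x| <= H * (kappa * rho n)}.
  move=> k0 Lw wk nw.
  have kr0 : 0 <= kappa * rho n by rewrite mulr_ge0// ltW.
  have := profile_error_le oO hk hPhi (t0 n) kr0 Lw wk nw.
  rewrite powt ?mulr_gt0 ?pi_gt0// -/P.
  rewrite (_ : kappa * rho n + kappa / (P * r n ^+ N) = H * (kappa * rho n))//.
  rewrite /H /rho exprMn; field.
  by rewrite !gt_eqF ?exprn_gt0.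
have Tlow n M : 0 <= M -> {ae lebesgue_rV R N, forall x, (~` C) x -> `|T n (v n) x| <= M} ->
    delta * rho n <= M.
  move=> M0 HM; rewrite -ler_pdivlMr//.
  apply: (low (r n)) => //; first by rewrite divr_ge0// ltW.
    exact: bO.
  apply: aeS HM => x HM xO.
  rewrite ler_pdivlMr// mulrC -[rho n]gtr0_norm// -normrM.
  rewrite -(profile_error_scale oO hk hPhi (rho n) (t0 n) (Lu n) xO).
  exact: HM.
have [|||||U [LU nU HU]] := @gliding_hump R N (~` C) oO T v rho delta H q q0 q2 (ltW H0)
  delta0 qH rho0 rhod _ _ _ _ _ Tlow.
- by move=> n a w w' x Lw Lw' xO; exact: (profile_error_linear oO hk hPhi).
- move=> n w kappa k0 Lw wk; apply: Tbd => //.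
  by apply: aeW => x _; exact: wk.
- by move=> n; exact: measurable_funM.
- move=> n x; rewrite /v normrM gtr0_norm// ger0_norm ?tbump0_ge0//.
  by rewrite ler_piMr ?tbump0_le1// ltW.
- move=> n; rewrite norm_L1Z//; last by case: (Lu n).
  rewrite gtr0_norm//.
  apply: (@le_trans _ _ ((rho n)%:E * ((2 * r n) ^+ N)%:E)%E).
    by rewrite lee_pmul2l ?lte_fin ?rho0//; exact: (norm_L1_tbump oO (c n) (r0 n)).
  by rewrite -EFinM mulVf// gt_eqF// exprn_gt0// mulr_gt0.
(* If [U] vanished almost everywhere, so would [T 0 U], against the lower bound at [n = 0]. This is
   why [Tbd] assumes its height bound only almost everywhere. *)
have nU0 : (0 < norm_Lp (~` C) 1%:E U)%E.
  rewrite lt0e Lnorm_ge0 andbT; apply/eqP => U0.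
  have := HU 0%N (H * (0 * rho 0%N)).
  rewrite mul0r mulr0 lexx => /(_ isT); rewrite leNgt !mulr_gt0 ?divr_gt0// => h.
  suff: false by []. apply: h.
  have := Tbd 0%N U 0 (lexx 0) LU; rewrite mul0r mulr0; apply; last by rewrite U0.
  by apply: aeS (norm_L1_eq0 oO LU U0) => x h xO; rewrite h// normr0.
have [nu nuE] : exists nu : R, norm_Lp (~` C) 1%:E U = nu%:E.
  by exists (fine (norm_Lp (~` C) 1%:E U)); rewrite fineK// ge0_fin_numE ?Lnorm_ge0//; case: LU.
rewrite nuE lte_fin in nU0; rewrite nuE lee_fin in nU.
have mU : @measurable_fun _ _ 'rV[measurableTypeR R]_N R (~` C) U by case: LU.
have n1 : norm_Lp (~` C) 1%:E (fun x => nu^-1 * U x) = 1%:E.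
  by rewrite norm_L1Z// nuE gtr0_norm ?invr_gt0// -EFinM mulVf// gt_eqF.
exists (fun x => nu^-1 * U x), t; split => //.
- by split; [exact: measurable_funM|rewrite n1 ltry].
- have /cvgryPge idn := @cvgr_idn R.
  apply/cvgryPge => A; apply: filterS (idn (A / tau)) => n.
  rewrite ler_pdivrMr// mulrC => /le_trans; apply; apply: le_trans (rt n).
  by rewrite ler_pM2l// (le_trans _ (r1 n))// lerDr addr_ge0.
move=> n; rewrite leNgt; apply/negP => lt.
pose M := g (t n) / (t n `^ (N%:R / 2)).
have gt0 : 0 < g (t n) by have /andP[] := g_range _ (ltW (t0 n)).
have tN0 : 0 < t n `^ (N%:R / 2) by exact: powR_gt0.
have M0 : 0 <= M by rewrite divr_ge0// ltW.
have leM : (norm_Lp (~` C) +oo (profile_error (~` C) k Phi (t n) (fun x => (nu^-1 * U x)%R)) <= M%:E)%E.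
  rewrite /M mulrC EFinM lee_pdivlMl//; exact: ltW lt.
move/(norm_Linfty_leP _ _ M0) in leM.
(* Undoing the normalisation multiplies the bound [M] by [nu <= 2]. *)
have := HU n (2 * M); rewrite mulr_ge0// => /(_ isT).
have /[swap]/[apply] : {ae lebesgue_rV R N, forall x, (~` C) x -> `|T n U x| <= 2 * M}.
  apply: aeS leM => x h xO; have := h xO.
  rewrite (profile_error_scale oO hk hPhi)// normrM gtr0_norm ?invr_gt0//.
  rewrite ler_pdivrMl// => /le_trans; apply; exact: ler_wpM2r.
have -> : M = g (t n) * 2 ^+ N / Q * rho n.
  have := powt 1 n ltr01; rewrite !mul1r -/Q => tE.
  rewrite /M tE /rho exprMn; field.
  by rewrite !gt_eqF ?exprn_gt0.
rewrite mulrA mulrA ler_pM2r// -mulrA leNgt => /negP; apply.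
have := gt n; rewrite /eps ltr_pdivlMr ?mulr_gt0 ?exprn_gt0// => h.
rewrite !mulrA ltr_pdivrMr//; lra.
Qed.
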